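(* (a) $L^1(\mathbb R^2)$ is dense in $\mathcal A_c(\mathbb R^2)$. (b) The test functions $\mathcal D(\mathbb R^2)=C_c^\infty(\mathbb R^2)$ are dense in $\mathcal A_c(\mathbb R^2)$. (Density is with respect to the Alexiewicz norm.)
   Context: $\overline{\mathbb R}=[-\infty,\infty]$ is the two-point compactification of $\mathbb R$, and $\overline{\mathbb R}^2$ carries the product topology. $\mathcal B_c(\overline{\mathbb R}^2)$ is the set of continuous $F:\overline{\mathbb R}^2\to\mathbb R$ with $F(-\infty,s)=F(s,-\infty)=0$ for all $s\in\overline{\mathbb R}$. $\partial_{12}=\partial_1\partial_2$ is the distributional derivative on $\mathbb R^2$. $\mathcal A_c(\mathbb R^2)=\{f\in\mathcal D'(\mathbb R^2)\mid f=\partial_{12}F\text{ for some }F\in\mathcal B_c(\overline{\mathbb R}^2)\}$; the primitive $F\in\mathcal B_c(\overline{\mathbb R}^2)$ of $f$ is unique, and the Alexiewicz norm is $\lVert f\rVert=\lVert F\rVert_\infty$. Each $f\in L^1(\mathbb R^2)$ (Lebesgue measure) is identified with the distribution it defines; it lies in $\mathcal A_c(\mathbb R^2)$ with primitive $F(x,y)=\int_{-\infty}^x\int_{-\infty}^y f$. *)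

(* Defs.v *)
From HB Require Import structures.
From mathcomp Require Import all_boot all_order all_algebra.
From mathcomp Require Import all_classical all_reals all_analysis.

Set Implicit Arguments.
Unset Strict Implicit.
Unset Printing Implicit Defensive.

Import Order.TTheory GRing.Theory Num.Theory.
Import numFieldNormedType.Exports.

Local Open Scope classical_set_scope.
Local Open Scope ring_scope.

Section smooth.
Context {R : realType}.
Implicit Types (phi psi : R * R -> R) (i : bool) (s : seq bool).

(* The two coordinates of the plane are indexed by bool: false is the first
   one, true the second. *)
Definition axis i : R * R := if i then (0, 1) else (1, 0).

Definition partial i phi : R * R -> R := fun z => 'D_(axis i) phi z.

Definition partials s phi : R * R -> R := foldr partial phi s.

Definition smooth phi := forall s,
  continuous (partials s phi) /\
  forall i z, derivable (partials s phi) z (axis i).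

Definition supp phi : set (R * R) := closure [set z | phi z != 0].

Definition test_pred : {pred R * R -> R} :=
  fun phi => `[< smooth phi /\ compact (supp phi) >].

Lemma test_predP phi : reflect (smooth phi /\ compact (supp phi)) (phi \in test_pred).
Proof. exact: asboolP. Qed.

Lemma partials_lin a phi psi s : smooth phi -> smooth psi ->
  partials s (a *: (phi : R * R -> R) + psi) =
  a *: (partials s phi : R * R -> R) + partials s psi.
Proof.
move=> sphi spsi; elim: s => //= i s ->.
have [_ dphi] := sphi s; have [_ dpsi] := spsi s.
apply/funext => z; rewrite /partial deriveD ?deriveZ//.
exact/derivableZ.
Qed.

Lemma smooth_lin a phi psi : smooth phi -> smooth psi ->
  smooth (a *: (phi : R * R -> R) + psi).
Proof.
move=> sphi spsi s; rewrite partials_lin//.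
have [cphi dphi] := sphi s; have [cpsi dpsi] := spsi s.
split=> [z|i z].
  by apply: continuousD; [exact: (continuousZl_tmp (cphi z))|exact: cpsi].
by apply: derivableD => //; exact/derivableZ.
Qed.

Lemma supp_lin a phi psi : compact (supp phi) -> compact (supp psi) ->
  compact (supp (a *: (phi : R * R -> R) + psi)).
Proof.
move=> cphi cpsi; have := compactU cphi cpsi.
rewrite -closureU => cU; apply: subclosed_compact cU _.
  exact: closed_closure.
apply: closureS => z /= nz.
have [phi0|] := eqVneq (phi z) 0; last by left.
by right; apply: contra_neq nz => psi0; rewrite !fctE phi0 psi0 scaler0 addr0.
Qed.

Lemma smooth0 : smooth (0 : R * R -> R).
Proof.
have E s : partials s (0 : R * R -> R) = cst 0.
  elim: s => //= i s ->; apply/funext => z.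
  by rewrite /partial derive_cst.
by move=> s; rewrite E; split=> *; [exact: cst_continuous|exact: derivable_cst].
Qed.

Lemma supp0 : supp (0 : R * R -> R) = set0.
Proof.
rewrite /supp (_ : [set _ | _] = set0) ?closure0//.
by apply/seteqP; split=> z //=; rewrite eqxx.
Qed.

Lemma test_submod_closed : submod_closed test_pred.
Proof.
split.
  apply/test_predP; split; first exact: smooth0.
  by rewrite supp0; exact: compact0.
move=> a phi psi /test_predP[s1 c1] /test_predP[s2 c2]; apply/test_predP.
by split; [exact: smooth_lin|exact: supp_lin].
Qed.

HB.instance Definition _ := GRing.isSubmodClosed.Build R (R * R -> R) test_pred
  test_submod_closed.

End smooth.

Record testfun (R : realType) := TestFun {
  test_val :> R * R -> R ;
  test_valP : test_val \in test_pred }.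

HB.instance Definition _ (R : realType) := [isSub for @test_val R].
HB.instance Definition _ (R : realType) := [Choice of testfun R by <:].
HB.instance Definition _ (R : realType) :=
  [SubChoice_isSubLmodule of testfun R by <:].

Section distributions.
Context {R : realType}.
Implicit Types (phi : testfun R) (T : testfun R -> R) (i : bool).

Lemma test_partial_subproof i phi : partial i phi \in test_pred.
Proof.
have /test_predP[sphi cphi] := test_valP phi; apply/test_predP; split.
  by move=> s; have := sphi (rcons s i); rewrite /partials foldr_rcons.
apply: subclosed_compact cphi _; first exact: closed_closure.
rewrite [X in _ `<=` X](closure_id _).1; last exact: closed_closure.
apply: closureS => z /= nz; apply: contrapT => zphi; move: nz; apply/negP.
rewrite negbK; apply/eqP.
have nz : \forall w \near z, phi w = cst 0 w.
  have : open (~` supp phi) by apply: closed_openC; exact: closed_closure.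
  rewrite openE => /(_ z zphi); apply: filterS => w /= wphi.
  by apply: contrapT => /eqP w0; apply: wphi; exact: subset_closure.
by rewrite /partial (near_eq_derive _ nz) ?derive_cst//; case: i.
Qed.

Definition test_partial i phi : testfun R := TestFun (test_partial_subproof i phi).

(* Convergence of sequences in D(R^2). *)
Definition test_cvg (phi_ : nat -> testfun R) phi :=
  (exists2 K : set (R * R), compact K & forall n, supp (phi_ n) `<=` K) /\
  forall s, {uniform, (fun n => partials s (phi_ n)) @ \oo --> partials s phi}.

(* The space D'(R^2); on D(R^2) a linear functional is continuous if and only
   if it is sequentially continuous. *)
Definition distributions : set (testfun R -> R) :=
  [set T : testfun R -> R | scalar T /\
    forall (phi_ : nat -> testfun R) phi,
      test_cvg phi_ phi -> T (phi_ n) @[n --> \oo] --> T phi].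

Definition distr_partial i T : testfun R -> R := fun phi => - T (test_partial i phi).

Definition d12 T : testfun R -> R := distr_partial false (distr_partial true T).

Local Notation lebesgue2 := (@lebesgue_measure R \x @lebesgue_measure R)%E.

(* This is a distribution when f is locally integrable. *)
Definition regular_distr (f : R * R -> R) : testfun R -> R :=
  fun phi => (\int[lebesgue2]_z (f z * phi z))%R.

Definition Bc : set (\bar R * \bar R -> R) :=
  [set F | continuous F /\ forall s, F (-oo, s)%E = 0 /\ F (s, -oo)%E = 0].

Definition restrict_plane (F : \bar R * \bar R -> R) : R * R -> R :=
  fun z => F (z.1%:E, z.2%:E).

Definition primitive_of T : set (\bar R * \bar R -> R) :=
  [set F | Bc F /\ T = d12 (regular_distr (restrict_plane F))].

Definition Ac : set (testfun R -> R) :=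
  [set T | distributions T /\ exists F, primitive_of T F].

(* An element of Ac has exactly one primitive; the default value 0 is only
   used outside of Ac. *)
Definition primitive T : \bar R * \bar R -> R := xget (cst 0) (primitive_of T).

Definition supnorm (F : \bar R * \bar R -> R) : R := sup (range (fun z => `|F z|)).

Definition alexiewicz T : R := supnorm (primitive T).

Definition dense_in_Ac (S : set (testfun R -> R)) :=
  S `<=` Ac /\
  forall T, Ac T -> forall e : R, 0 < e ->
    exists2 U, S U & alexiewicz (T - U) < e.

(* Borel representatives: every Lebesgue integrable function agrees almost
   everywhere with a Borel one, so both define the same distributions. *)
Definition L1_distr : set (testfun R -> R) :=
  [set regular_distr f | f in [set f : R * R -> R |
    lebesgue2.-integrable setT (EFin \o f)]].

Definition test_distr : set (testfun R -> R) :=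
  [set regular_distr phi | phi in [set: testfun R]].

End distributions.

(* Main.v *)
Require Import Defs.
From HB Require Import structures.
From mathcomp Require Import all_boot all_order all_algebra.
From mathcomp Require Import all_classical all_reals all_analysis.
From mathcomp Require Import measurable_realfun.
From mathcomp Require Import ring lra.

Set Implicit Arguments.
Unset Strict Implicit.
Unset Printing Implicit Defensive.

Import Order.TTheory GRing.Theory Num.Theory.
Import numFieldNormedType.Exports.

Local Open Scope classical_set_scope.
Local Open Scope ring_scope.

(** The primitive map identifies the Alexiewicz norm of a distribution with the
supremum norm of its primitive on the compact extended plane, so density is a
statement about uniform approximation of the functions of Bc.

An integrable f has the primitive [cumul f], its integral over the quadrant
below a point. Dominated convergence makes it continuous on the extended plane
([cumul_continuous]), and Fubini's theorem applied to pairs of points gives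
f = d12 (cumul f) ([cumul_by_parts]), because the integral of d12 phi over the
quadrant above z is phi z. Hence L^1, and with it every test function, lies in
Ac ([L1_distr_Ac]).

Given F in Bc, uniform continuity provides a finite grid of real nodes on whose
cells, including the unbounded ones, F oscillates little ([grid],
[Heine_Cantor]). Interpolating F at the nodes, in each variable, with smooth
ramps instead of affine pieces gives a function close to F ([interp2_close])
which is a finite sum of tensor products of ramps. Its mixed derivative is a
test function, and that test function has the interpolation as its primitive
([staircase2_primitive]). So the primitives of test functions are uniformly
dense in Bc ([test_approx]), so test functions are dense in Ac, and then so is
L^1, which contains them.

The norm is defined through a chosen primitive, so uniqueness of primitives is
needed to compute it. If d12 F = 0, testing F against tensor products of
differences of ramps shows that four averages of F over small rectangles, near
a given point and near three points where some coordinate is -oo, have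
alternating sum 0; the last three are small by the boundary condition
([Bc_unique_point], [primitive_unique]). *)

(** * Smooth step functions on the line *)

Section step.
Context {R : realType}.
Implicit Types (x : R) (f g : R -> R) (k : nat).

(** The derivatives of the classical flat function exp(-1/x) are combinations of
the functions of this family, which is therefore all that has to be studied. *)
Definition flat k x : R := if 0 < x then x^-1 ^+ k * expR (- x^-1) else 0.

Lemma flat_le0 k x : x <= 0 -> flat k x = 0.
Proof. by rewrite /flat leNgt; case: ltP. Qed.

Lemma flat_gt0 k x : 0 < x -> 0 < flat k x.
Proof. by move=> x0; rewrite /flat x0 mulr_gt0 ?expR_gt0// exprn_gt0// invr_gt0. Qed.

Lemma flat_ge0 k x : 0 <= flat k x.
Proof. by case: (leP x 0) => [/flat_le0->|/(flat_gt0 k)/ltW]. Qed.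

Lemma flatS k x : flat k.+1 x * x = flat k x.
Proof.
rewrite /flat; case: ifPn => [x0|_]; last by rewrite mul0r.
by rewrite exprS mulrAC (mulrC _ x) mulrA divff ?gt_eqF// mul1r.
Qed.

(** With t = 1/x, this is the bound t^(k+1) <= (k+1)! exp t. It gives both the
continuity at 0 and, one index higher, the vanishing of the derivative there. *)
Lemma flat_le k x : `|flat k x| <= (k.+1)`!%:R * `|x|.
Proof.
case: (leP x 0) => [/flat_le0->|x0]; first by rewrite normr0 mulr_ge0.
rewrite (gtr0_norm (flat_gt0 k x0)) gtr0_norm// /flat x0 expRN.
have t0 : 0 < x^-1 by rewrite invr_gt0.
rewrite ler_pdivrMr ?expR_gt0//.
apply: (@le_trans _ _ ((k.+1)`!%:R * x * (x^-1 ^+ k.+1 / (k.+1)`!%:R))).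
  have F0 : (k.+1)`!%:R != 0 :> R by rewrite pnatr_eq0 -lt0n fact_gt0.
  rewrite exprS; set F := (_ `!)%:R.
  rewrite (_ : _ * _ = (x / x) * (F / F) * x^-1 ^+ k); last by ring.
  by rewrite (divff F0) divff ?gt_eqF// !mul1r.
rewrite ler_wpM2l//; first by rewrite mulr_ge0// ltW.
by apply: le_trans (expR_ge1Dxn k (ltW t0)); rewrite lerDr.
Qed.

Lemma flat_continuous0 k : {for 0, continuous (flat k)}.
Proof.
rewrite /prop_for /continuous_at [X in _ --> X]flat_le0//.
apply/norm_cvg0P.
apply: (@squeeze_cvgr _ _ _ _ (cst 0) (fun x => (k.+1)`!%:R * `|x|)).
- by near=> x; rewrite normr_ge0 flat_le.
- exact: cvg_cst.
- have : (k.+1)`!%:R * `|x : R| @[x --> (0 : R)] --> (k.+1)`!%:R * `|0 : R|.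
    by apply: cvgMl_tmp; apply: cvg_norm; exact: cvg_id.
  by rewrite normr0 mulr0.
Unshelve. all: by end_near. Qed.

(** At 0 the difference quotient of [flat k] is [flat k.+1], by [flatS], so
Caratheodory's criterion reduces the only delicate point to continuity. *)
Lemma is_derive_flat k x :
  is_derive x 1 (flat k) (flat k.+2 x - k%:R * flat k.+1 x).
Proof.
have [x0|x0|->] := ltgtP x 0.
- rewrite !flat_le0 ?ltW// mulr0 subr0.
  apply: (near_eq_is_derive (f := cst 0)) => //.
  by near=> y; rewrite [RHS]flat_le0//; near: y; apply: filterS (lt_nbhsl x0) => y /ltW.
- apply: (@near_eq_is_derive R R R (fun y : R => y^-1 ^+ k * expR (- y^-1))).
    by near=> y; rewrite /flat ifT//; near: y; exact: (lt_nbhsr x0).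
  have dV : is_derive x 1 (fun y : R => y^-1) (- x^-1 ^+ 2).
    apply: is_derive_eq; first by apply: (@is_deriveV R id x 1); rewrite gt_eqF.
    by rewrite exprVn /GRing.scale/= mulr1.
  have d1 : is_derive x 1 (fun y : R => y^-1 ^+ k)
     ((k%:R * x^-1 ^+ k.-1) *: (- x^-1 ^+ 2)).
    rewrite (_ : (fun _ => _) = (fun y : R => y^-1) ^+ k); last first.
      by apply/funext => y; rewrite exprfctE.
    exact: is_deriveX.
  have d2 : is_derive x 1 (fun y : R => expR (- y^-1))
     (x^-1 ^+ 2 * expR (- x^-1)).
    have dN : is_derive x 1 (fun y : R => - y^-1) (x^-1 ^+ 2).
      by rewrite -[X in is_derive _ _ _ X]opprK; exact: is_deriveN.
    rewrite mulrC; exact: (is_derive1_comp (f := expR) (g := fun y => - y^-1)).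
  apply: (is_derive_eq (is_deriveM d1 d2)).
  rewrite /flat x0 /GRing.scale/=; case: k d1 => [|k] d1 /=; rewrite !exprS; ring.
- rewrite !flat_le0// mulr0 subr0; apply/is_derive1_caratheodory.
  exists (flat k.+1); split; last by rewrite flat_le0.
    by move=> y; rewrite (flat_le0 k (lexx 0)) !subr0 flatS.
  exact: flat_continuous0.
Unshelve. all: by end_near. Qed.

(** A class of functions that is visibly stable under derivation: smoothness of
a member then needs no bookkeeping of higher derivatives. *)
Inductive elementary : (R -> R) -> Prop :=
| elem_flat k : elementary (flat k)
| elem_aff f a b : elementary f -> elementary (fun x => f (a * x + b))
| elem_add f g : elementary f -> elementary g -> elementary (fun x => f x + g x)
| elem_scale f a : elementary f -> elementary (fun x => a * f x)
| elem_mul f g : elementary f -> elementary g -> elementary (fun x => f x * g x)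
| elem_inv f : elementary f -> (forall x, f x != 0) -> elementary (fun x => (f x)^-1).

Lemma elem_is_derive f : elementary f ->
  exists2 g, elementary g & forall x, is_derive x 1 f (g x).
Proof.
elim=> {f} [k|f a b _ [g eg df]|f1 f2 e1 [g1 eg1 df1] e2 [g2 eg2 df2]|
           f a ef [g eg df]|f1 f2 e1 [g1 eg1 df1] e2 [g2 eg2 df2]|f ef [g eg df] f0].
- exists (fun x => flat k.+2 x + (- k%:R) * flat k.+1 x).
    by apply: elem_add; [|apply: elem_scale]; exact: elem_flat.
  by move=> x; apply: is_derive_eq; [exact: is_derive_flat|rewrite mulNr].
- exists (fun x => a * g (a * x + b)); first exact/elem_scale/elem_aff.
  move=> x; rewrite mulrC.
  apply: (is_derive1_comp (f := f) (g := fun y => a * y + b)) => //.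
  rewrite -[X in is_derive _ _ _ X]addr0 -[X in is_derive _ _ _ (X + _)]mulr1.
  exact: is_deriveD.
- by exists (fun x => g1 x + g2 x); [exact: elem_add|move=> x; exact: is_deriveD].
- by exists (fun x => a * g x); [exact: elem_scale|move=> x; exact: is_deriveZ].
- exists (fun x => f1 x * g2 x + f2 x * g1 x).
    by apply: elem_add; exact: elem_mul.
  by move=> x; exact: is_deriveM.
- exists (fun x => (- 1) * ((f x)^-1 * (f x)^-1 * g x)).
    by apply: elem_scale; do 2 apply: elem_mul => //; exact: elem_inv.
  move=> x; apply: (is_derive_eq (is_deriveV (f0 x) (df x))).
  by rewrite /GRing.scale/= mulNr mul1r -expr2 exprVn mulNr.
Qed.

Lemma elem_derive1 f : elementary f -> elementary (derive1 f).
Proof.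
case/elem_is_derive => g eg df; rewrite (_ : derive1 f = g)//.
by apply/funext => x; rewrite derive1E derive_val.
Qed.

Lemma elem_derivable f x : elementary f -> derivable f x 1.
Proof. by case/elem_is_derive => g _ /(_ x) []. Qed.

Lemma elem_continuous f : elementary f -> continuous f.
Proof.
move=> ef x; apply/differentiable_continuous/derivable1_diffP.
exact: elem_derivable.
Qed.

Lemma elem_lin a f g : elementary f -> elementary g ->
  elementary (fun x => a * f x + g x).
Proof. by move=> ef eg; apply: elem_add => //; exact: elem_scale. Qed.

Lemma derive1_lin a f g x : derivable f x 1 -> derivable g x 1 ->
  derive1 (fun y => a * f y + g y) x = a * derive1 f x + derive1 g x.
Proof.
move=> /derivableP df /derivableP dg; rewrite !derive1E.
by have [_ ->] := is_deriveD (is_deriveZ a df) dg.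
Qed.

(** Both flat functions cannot vanish together, so the quotient is smooth; it is
0 before 0 and 1 after 1. *)
Definition step x : R := flat 0 x / (flat 0 x + flat 0 (-1 * x + 1)).

Lemma step_den_neq0 x : flat 0 x + flat 0 (-1 * x + 1) != 0.
Proof.
rewrite gt_eqF//; case: (ltP 0 x) => x0.
  by rewrite ltr_wpDr ?flat_ge0 ?flat_gt0.
by rewrite ltr_wpDl ?flat_ge0 ?flat_gt0//; lra.
Qed.

Lemma elem_step : elementary step.
Proof.
apply: elem_mul; first exact: elem_flat.
apply: elem_inv; last exact: step_den_neq0.
by apply: elem_add; [exact: elem_flat|apply: elem_aff; exact: elem_flat].
Qed.

Lemma step_le0 x : x <= 0 -> step x = 0.
Proof. by move=> x0; rewrite /step flat_le0// mul0r. Qed.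

Lemma step_ge1 x : 1 <= x -> step x = 1.
Proof.
move=> x1; have := step_den_neq0 x; rewrite /step.
by rewrite (flat_le0 0 (x := _ + 1)) ?addr0; [exact: divff|lra].
Qed.

Lemma step_itv x : 0 <= step x <= 1.
Proof.
have a0 := flat_ge0 0 x; have b0 := flat_ge0 0 (-1 * x + 1).
have ab0 : 0 < flat 0 x + flat 0 (-1 * x + 1).
  by rewrite lt_neqAle eq_sym step_den_neq0 addr_ge0.
by rewrite /step divr_ge0 ?(ltW ab0)//= ler_pdivrMr// mul1r lerDl.
Qed.

(** By the quotient rule the derivative is (a' b - a b') / (a + b)^2, where a is
increasing and b is decreasing. *)
Lemma step_derive1_ge0 x : 0 <= derive1 step x.
Proof.
pose a := flat 0 x; pose b := flat 0 (-1 * x + 1).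
pose a' := flat 2 x; pose b' := -1 * flat 2 (-1 * x + 1).
have da : is_derive x 1 (flat 0) a'.
  by apply: (is_derive_eq (is_derive_flat 0 x)); rewrite mul0r subr0.
have db : is_derive x 1 (fun y => flat 0 (-1 * y + 1)) b'.
  rewrite /b' mulrC; apply: (is_derive1_comp (f := flat 0) (g := fun y => -1 * y + 1)).
    by apply: (is_derive_eq (is_derive_flat 0 _)); rewrite mul0r subr0.
  rewrite -[X in is_derive _ _ _ X]addr0 -[X in is_derive _ _ _ (X + _)]mulr1.
  exact: is_deriveD.
have d1 := @is_deriveV _ (fun y => flat 0 y + flat 0 (-1 * y + 1)) x _ 1
  (step_den_neq0 x) (is_deriveD da db).
have [_ d2] := is_deriveM da d1.
rewrite derive1E; rewrite [leRHS]d2 /GRing.scale/=.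
rewrite -/a -/b.
have ab := step_den_neq0 x; rewrite -/a -/b in ab.
rewrite (_ : _ + _ = (a' * b - a * b') / (a + b) ^+ 2); last by field.
rewrite divr_ge0 ?sqr_ge0// subr_ge0 (@le_trans _ _ 0)//.
  by rewrite mulr_ge0_le0 ?flat_ge0// /b' mulN1r oppr_le0 flat_ge0.
by rewrite mulr_ge0 ?flat_ge0.
Qed.

(** The step moved to the segment [u, v]. *)
Definition ramp (u v : R) x := step ((v - u)^-1 * x + (- u / (v - u))).

Section ramp.
Variables (u v : R) (uv : u < v).
Let arg x : (v - u)^-1 * x + (- u / (v - u)) = (x - u) / (v - u).
Proof. by ring. Qed.

Lemma elem_ramp : elementary (ramp u v).
Proof. exact/elem_aff/elem_step. Qed.

Lemma ramp_le x : x <= u -> ramp u v x = 0.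
Proof.
by move=> xu; rewrite /ramp arg step_le0// pmulr_lle0 ?invr_gt0 subr_cp0.
Qed.

Lemma ramp_ge x : v <= x -> ramp u v x = 1.
Proof.
by move=> xu; rewrite /ramp arg step_ge1// ler_pdivlMr ?mul1r ?subr_gt0// lerD2r.
Qed.

Lemma ramp_itv x : 0 <= ramp u v x <= 1.
Proof. exact: step_itv. Qed.

Lemma ramp_derive1_ge0 x : 0 <= derive1 (ramp u v) x.
Proof.
have ds := derivableP (@elem_derivable step ((v - u)^-1 * x + (- u / (v - u))) elem_step).
have dg : is_derive x 1 (fun y => (v - u)^-1 * y + (- u / (v - u))) (v - u)^-1.
  rewrite -[X in is_derive _ _ _ X]addr0 -[X in is_derive _ _ _ (X + _)]mulr1.
  exact: is_deriveD.
have [_ d] := is_derive1_comp (f := step)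
  (g := fun y => (v - u)^-1 * y + (- u / (v - u))) ds dg.
rewrite derive1E [leRHS]d mulr_ge0 -?derive1E ?step_derive1_ge0//.
by rewrite invr_ge0 subr_ge0 ltW.
Qed.

Lemma ramp_derive1_lt x : x < u -> derive1 (ramp u v) x = 0.
Proof.
move=> xu; rewrite derive1E (@near_eq_derive _ R R _ (cst 0)) ?derive_cst//.
by near=> y; rewrite [LHS]ramp_le//; near: y; apply: filterS (lt_nbhsl xu) => y /ltW.
Unshelve. all: by end_near. Qed.

Lemma ramp_derive1_gt x : v < x -> derive1 (ramp u v) x = 0.
Proof.
move=> xv; rewrite derive1E (@near_eq_derive _ R R _ (cst 1)) ?derive_cst//.
by near=> y; rewrite [LHS]ramp_ge//; near: y; apply: filterS (lt_nbhsr xv) => y /ltW.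
Unshelve. all: by end_near. Qed.

End ramp.
End step.
(** * Tensor products *)

Section tensor.
Context {R : realType}.
Implicit Types (f g : R -> R) (phi : R * R -> R) (z : R * R) (i : bool).

Definition coord i z : R := if i then z.2 else z.1.

Definition line i z : R -> R * R := fun t => if i then (z.1, t) else (t, z.2).

(** Along an axis, a function of the plane is a function of one variable: this
reduces the directional derivatives to ordinary ones. *)
Lemma derivable_axis phi z i :
  derivable phi z (axis i) = derivable (phi \o line i z) (coord i z) 1.
Proof.
rewrite /derivable (_ : (fun h => _) = (fun h => h^-1 *:
  ((phi \o line i z) (h *: 1 + coord i z) - (phi \o line i z) (coord i z))))//.
apply/funext => h /=; congr (_ *: (phi _ - phi _)); case: z i => x y [] //=;
  by apply/pair_equal_spec; split; rewrite /= /GRing.scale/= ?mulr0 ?add0r.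
Qed.

Lemma partialE phi z i : partial i phi z = derive1 (phi \o line i z) (coord i z).
Proof.
rewrite /partial derive1E /derive (_ : (fun h => _) = (fun h => h^-1 *:
  ((phi \o line i z) (h *: 1 + coord i z) - (phi \o line i z) (coord i z))))//.
apply/funext => h /=; congr (_ *: (phi _ - phi _)); case: z i => x y [] //=;
  by apply/pair_equal_spec; split; rewrite /= /GRing.scale/= ?mulr0 ?add0r.
Qed.

Definition tensor f g : R * R -> R := fun z => f z.1 * g z.2.

Lemma tensor_line f g i z : tensor f g \o line i z =
  (if i then f z.1 else g z.2) *: (if i then g else f : R -> R^o).
Proof. by apply/funext => t; case: i => //; exact: mulrC. Qed.

Lemma partial_tensor f g i : elementary f -> elementary g ->
  partial i (tensor f g) =
  if i then tensor f (derive1 g) else tensor (derive1 f) g.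
Proof.
move=> ef eg; apply/funext => z; rewrite partialE tensor_line.
rewrite derive1E deriveZ; last by case: i; exact: elem_derivable.
by case: i => /=; rewrite -derive1E //; exact: mulrC.
Qed.

(** Every iterated partial derivative of a tensor product is again the tensor
product of two functions of the class [elementary]. *)
Lemma smooth_tensor f g : elementary f -> elementary g -> smooth (tensor f g).
Proof.
move=> ef eg s.
have [f' [g' [ef' eg' ->]]] : exists f' g',
    [/\ elementary f', elementary g' & partials s (tensor f g) = tensor f' g'].
  elim: s => [|i s [f' [g' [ef' eg' ih]]]]; first by exists f, g.
  rewrite /= ih partial_tensor//; case: i.
    by exists f', (derive1 g'); split => //; exact: elem_derive1.
  by exists (derive1 f'), g'; split => //; exact: elem_derive1.
split=> [z|i z].
  apply: cvgM; apply: continuous_comp; try exact: cvg_fst; try exact: cvg_snd.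
    exact: elem_continuous.
  exact: elem_continuous.
rewrite derivable_axis tensor_line.
by apply: derivableZ; case: i; exact: elem_derivable.
Qed.

Lemma d12_tensor f g : elementary f -> elementary g ->
  partials [:: true; false] (tensor f g) = tensor (derive1 f) (derive1 g).
Proof.
by move=> ef eg; rewrite /= !partial_tensor//; exact: elem_derive1.
Qed.

End tensor.

(** * Integrals of mixed derivatives over the plane *)

Section plane.
Context {R : realType}.
Implicit Types (phi psi F : R * R -> R) (z w : R * R) (i : bool).

Local Notation plane := (measurableTypeR R * measurableTypeR R)%type.
Local Notation mu := (@lebesgue_measure R).
Local Notation mu2 := (@lebesgue_measure R \x @lebesgue_measure R)%E.

(** The plane is second countable: an open set is the union of the open squares
with rational centre and radius that it contains, and these are measurable
rectangles. Hence continuous functions are measurable for the product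
sigma-algebra. *)
Lemma open_measurable_plane (U : set (R * R)) : open U -> @measurable _ plane U.
Proof.
move=> oU.
pose box (p q r : rat) : set (R * R) :=
  [set` `]ratr p - ratr r, ratr p + ratr r[%R] `*`
  [set` `]ratr q - ratr r, ratr q + ratr r[%R].
pose V := \bigcup_p \bigcup_q \bigcup_r
  if pselect (box p q r `<=` U) then box p q r else set0.
have -> : U = V.
  apply/seteqP; split=> [z Uz|z]; last first.
    by case=> p _ [q _ [r _]]; case: pselect => // bU /bU.
  move: oU; rewrite openE => /(_ z Uz) /nbhs_ballP[e /= e0 zeU].
  have [p] := @rat_in_itvoo R (z.1 - e / 4) (z.1 + e / 4) ltac:(lra).
  rewrite in_itv/= => /andP[p1 p2].
  have [q] := @rat_in_itvoo R (z.2 - e / 4) (z.2 + e / 4) ltac:(lra).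
  rewrite in_itv/= => /andP[q1 q2].
  have [r] := @rat_in_itvoo R (e / 4) (e / 2) ltac:(lra).
  rewrite in_itv/= => /andP[r1 r2].
  exists p => //; exists q => //; exists r => //; case: pselect => [bU|]; last first.
    case=> -[x y] [] /=; rewrite !in_itv/= => /andP[x1 x2] /andP[y1 y2].
    by apply: zeU; split=> /=; rewrite /ball/= ltr_norml; lra.
  by split; rewrite /= in_itv/=; lra.
apply: bigcupT_measurable_rat => p; apply: bigcupT_measurable_rat => q.
apply: bigcupT_measurable_rat => r; case: pselect => [bU|nbU] //=.
by apply: measurableX; exact: measurable_itv.
Qed.

Lemma continuous_measurable_plane F : continuous F -> measurable_fun [set: plane] F.
Proof.
move=> /continuousP cF; apply: (measurability _
  (measurable_realfun.RGenOpens.measurableE R)).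
move=> _ [_ [a [b ->] <-]]; rewrite setTI.
by apply: open_measurable_plane; apply: cF; apply: interval_open.
Qed.

Definition rect (a b c d : R) : set (R * R) := [set` `[a, b]%R] `*` [set` `[c, d]%R].

Lemma compact_rect a b c d : compact (rect a b c d).
Proof. by apply: compact_setX; exact: segment_compact. Qed.

Lemma measurable_rect a b c d : @measurable _ plane (rect a b c d).
Proof. by apply: measurableX; exact: measurable_itv. Qed.

Lemma rect_finite a b c d : (mu2 (rect a b c d) < +oo)%E.
Proof.
rewrite /rect product_measure1E//.
have fin (x y : R) : mu `[x, y] \is a fin_num.
  by rewrite fin_num_abs gee0_abs//; apply: compact_finite_measure; exact: segment_compact.
apply: lte_mul_pinfty; [by []|exact: fin|].
by rewrite ltey_eq; apply/orP; left; exact: fin.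
Qed.

Lemma continuous_bounded_rect phi a b c d : continuous phi ->
  [bounded phi z | z in rect a b c d].
Proof.
move=> cphi; have /compact_bounded[M [Mr MB]] :=
  continuous_compact (continuous_subspaceT cphi) (@compact_rect a b c d).
by exists M; split=> // N MN z zr; apply: MB => //=; exists z.
Qed.

Lemma integrable_rect phi a b c d : continuous phi ->
  mu2.-integrable (rect a b c d) (EFin \o phi).
Proof.
move=> cphi; apply: measurable_bounded_integrable.
- exact: measurable_rect.
- exact: rect_finite.
- by apply: measurable_funTS; exact: continuous_measurable_plane.
- exact: continuous_bounded_rect.
Qed.

(** Support in a centred square, in the form used to cut integrals down to
compact rectangles. *)
Definition vanishes_off (M : R) phi :=
  forall z, M < `|z.1| \/ M < `|z.2| -> phi z = 0.

Lemma vanishes_off_rect M phi : vanishes_off M phi ->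
  phi \_ (rect (- M) M (- M) M) = phi.
Proof.
move=> v; apply/funext => z; rewrite patchE; case: ifPn => // /negP zM.
apply/esym/v; apply: contrapT => /not_orP[/negP]; rewrite -leNgt => z1 /negP.
by rewrite -leNgt => z2; apply: zM; rewrite inE; split; rewrite /= in_itv/= -ler_norml.
Qed.

Lemma integrable_vanishes_off M phi : continuous phi -> vanishes_off M phi ->
  mu2.-integrable setT (EFin \o phi).
Proof.
move=> cphi /vanishes_off_rect <-; rewrite -restrict_EFin.
apply: (integrable_restrict _ (@measurable_rect _ _ _ _) measurableT _).1.
by rewrite setTI; exact: integrable_rect.
Qed.

Lemma bounded_vanishes_off M phi : continuous phi -> vanishes_off M phi ->
  exists2 C, 0 <= C & forall z, `|phi z| <= C.
Proof.
move=> cphi v; have := @continuous_bounded_rect phi (- M) M (- M) M cphi.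
move=> [C [_ Cb]]; exists (Num.max 0 (C + 1)); first by rewrite le_max lexx.
move=> z; rewrite -(vanishes_off_rect v) patchE; case: ifPn => [|_].
  by rewrite inE => zr; rewrite le_max (Cb (C + 1))// ?orbT// ltrDl.
by rewrite normr0 le_max lexx.
Qed.

Lemma compact_supp_vanishes_off phi : compact (supp phi) ->
  exists2 M, 0 < M & vanishes_off M phi.
Proof.
move=> /compact_bounded[N [_ NB]]; exists (Num.max 1 (N + 1)).
  by rewrite lt_max ltr01.
move=> z Mz.
apply: contrapT => /eqP phiz.
have : `|z| <= N + 1 by apply: NB; [rewrite ltrDl|exact: subset_closure].
rewrite prod_normE ge_max => /andP[z1 z2].
by case: Mz; rewrite gt_max => /andP[_]; rewrite ltNge ?z1 ?z2.
Qed.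

Lemma integral_derive1 (f F : R -> R) a b : a <= b -> continuous f ->
  (forall x, derivable F x 1) -> derive1 F = f ->
  (\int[mu]_(x in `[a, b]) (f x)%:E = (F b - F a)%:E)%E.
Proof.
rewrite le_eqVlt => /predU1P[->|ab] cf dF F'.
  by rewrite set_itv1 integral_set1 subrr.
have cF : continuous F.
  by move=> x; apply/differentiable_continuous/derivable1_diffP.
rewrite (continuous_FTC2 ab _ _ (fun x _ => congr1 (@^~ x) F')) ?EFinB//.
  exact: continuous_subspaceT.
by split=> [x _||]; [exact: dF|apply: cvg_at_right_filter; exact: cF|
  apply: cvg_at_left_filter; exact: cF].
Qed.

Lemma integral_rect (g : R * R -> R) a b c d : continuous g ->
  (\int[mu2]_(z in rect a b c d) (g z)%:E =
   \int[mu]_(x in `[a, b]) \int[mu]_(y in `[c, d]) (g (x, y))%:E)%E.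
Proof.
move=> cg; rewrite integral_mkcond -integral12_prod_meas1; last first.
  apply: (integrable_restrict _ (@measurable_rect _ _ _ _) measurableT _).1.
  by rewrite setTI; exact: integrable_rect.
rewrite [RHS]integral_mkcond; apply: eq_integral => x _.
rewrite /fubini_F patchE; case: ifPn => xab.
  rewrite [RHS]integral_mkcond; apply: eq_integral => y _; rewrite !patchE.
  suff -> : ((x, y) \in rect a b c d) = (y \in `[c, d]%classic) by [].
  apply/idP/idP; rewrite !inE; first by case.
  by split=> //; rewrite inE in xab.
apply: integral0_eq => y _; rewrite patchE ifN//; apply: contra xab.
by rewrite !inE => -[].
Qed.

Lemma continuous_pairl (y : R) : continuous (fun x : R => (x, y)).
Proof. by move=> x; exact: (cvg_pair cvg_id (cvg_cst y)). Qed.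

Lemma continuous_pairr (x : R) : continuous (fun y : R => (x, y)).
Proof. by move=> y; exact: (cvg_pair (cvg_cst x) cvg_id). Qed.

(** Fubini's theorem and two applications of the fundamental theorem of calculus:
the mixed derivative integrates to the rectangular increment. *)
Lemma integral_rect_d12 phi a b c d : smooth phi -> a <= b -> c <= d ->
  (\int[mu2]_(z in rect a b c d) (partials [:: true; false] phi z)%:E =
   (phi (b, d) - phi (a, d) - (phi (b, c) - phi (a, c)))%:E)%E.
Proof.
move=> sphi ab cd.
have [_ d0] := sphi [::]; have [c1 d1] := sphi [:: false].
have [c2 _] := sphi [:: true; false].
rewrite integral_rect//.
transitivity (\int[mu]_(x in `[a, b])
    (partial false phi (x, d) - partial false phi (x, c))%:E)%E.
  apply: eq_integral => x _.
  apply: (@integral_derive1 (fun y => partials [:: true; false] phi (x, y))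
    (fun y => partial false phi (x, y)) _ _ cd).
  - by move=> y; apply: continuous_comp; [exact: continuous_pairr|exact: c2].
  - by move=> y; have := d1 true (x, y); rewrite derivable_axis.
  - by apply/funext => y; rewrite [RHS]partialE.
rewrite (integral_derive1 (F := fun x => phi (x, d) - phi (x, c)))//.
- by congr EFin; ring.
- move=> x; apply: cvgB; apply: continuous_comp;
    [exact: continuous_pairl|exact: c1|exact: continuous_pairl|exact: c1].
- move=> x; apply: derivableB.
    by have := d0 false (x, d); rewrite derivable_axis.
  by have := d0 false (x, c); rewrite derivable_axis.
- apply/funext => x; rewrite derive1E deriveB -?derive1E.
  + by rewrite !partialE.
  + by have := d0 false (x, d); rewrite derivable_axis.
  + by have := d0 false (x, c); rewrite derivable_axis.
Qed.

Definition le2 z w : bool := (z.1 <= w.1) && (z.2 <= w.2).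

Lemma integral_eq_rect (g h : R * R -> R) a b c d :
  (forall z, h z = (z \in rect a b c d)%:R * g z) ->
  (\int[mu2]_z (h z)%:E = \int[mu2]_(z in rect a b c d) (g z)%:E)%E.
Proof.
move=> hg; rewrite [RHS]integral_mkcond; apply: eq_integral => z _.
by rewrite hg patchE; case: ifPn => _; rewrite ?mul1r ?mul0r.
Qed.

Lemma in_rect a b c d z :
  (z \in rect a b c d) = [&& a <= z.1, z.1 <= b, c <= z.2 & z.2 <= d].
Proof.
apply/idP/idP; rewrite inE /rect/= !in_itv/=.
  by case=> /andP[-> ->] /andP[-> ->].
by case/and4P => -> -> -> ->.
Qed.

(** Far enough to the upper right phi vanishes, so of the four corners of the
rectangle that carries the integrand only z contributes. *)
Lemma integral_upper_quadrant M phi z : smooth phi -> vanishes_off M phi ->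
  vanishes_off M (partials [:: true; false] phi) ->
  (\int[mu2]_w ((le2 z w)%:R * partials [:: true; false] phi w)%:E = (phi z)%:E)%E.
Proof.
move=> sphi v v12; pose N := Num.max (M + 1) (Num.max `|z.1| `|z.2|).
have [z1N z2N] : z.1 <= N /\ z.2 <= N.
  by split; rewrite !le_max real_ler_norm ?num_real ?orbT.
have MN : M < `|N|.
  by rewrite (@lt_le_trans _ _ N) ?ler_norm// lt_max ltrDl ltr01.
rewrite (@integral_eq_rect (partials [:: true; false] phi) _ z.1 N z.2 N).
  rewrite integral_rect_d12// !(v (_, N)) ?(v (N, _))/=; try by [left|right].
  by rewrite !(subr0, sub0r) opprK -surjective_pairing.
move=> w; case: (eqVneq (partials [:: true; false] phi w) 0) => [->|w0].
  by rewrite !mulr0.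
congr (_%:R * _); rewrite in_rect /le2.
have /andP[-> ->] : (w.1 <= N) && (w.2 <= N); last by rewrite andbT.
have wN : ~ (M < `|w.1| \/ M < `|w.2|) by move=> /v12/eqP; rewrite (negbTE w0).
move/not_orP : wN => [/negP]; rewrite -leNgt => w1 /negP; rewrite -leNgt => w2.
have NM : M <= N by rewrite le_max lerDl ler01.
by apply/andP; split; apply: le_trans NM; apply: le_trans (ler_norm _) _.
Qed.

(** Here the three other corners lie where phi vanishes to the left or below. *)
Lemma integral_lower_quadrant M phi z : smooth phi ->
  (forall w, w.1 <= - M \/ w.2 <= - M -> phi w = 0) ->
  vanishes_off M (partials [:: true; false] phi) ->
  (\int[mu2]_w ((le2 w z)%:R * partials [:: true; false] phi w)%:E = (phi z)%:E)%E.
Proof.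
move=> sphi v v12; pose N := Num.max M (Num.max `|z.1| `|z.2|).
have [z1N z2N] : - N <= z.1 /\ - N <= z.2.
  have lN (x : R) : - x <= `|x| by rewrite -normrN ler_norm.
  by split; rewrite lerNl !le_max lN ?orbT.
have MN : - N <= - M by rewrite lerN2 le_max lexx.
rewrite (@integral_eq_rect (partials [:: true; false] phi) _ (- N) z.1 (- N) z.2).
  rewrite integral_rect_d12// !(v (_, - N)) ?(v (- N, _))/=; try by [left|right].
  by rewrite !subr0 -surjective_pairing.
move=> w; case: (eqVneq (partials [:: true; false] phi w) 0) => [->|w0].
  by rewrite !mulr0.
congr (_%:R * _); rewrite in_rect /le2.
suff /andP[-> ->] : (- N <= w.1) && (- N <= w.2) by [].
have wN : ~ (M < `|w.1| \/ M < `|w.2|) by move=> /v12/eqP; rewrite (negbTE w0).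
move/not_orP : wN => [/negP]; rewrite -leNgt => w1 /negP; rewrite -leNgt => w2.
move: w1 w2; rewrite !ler_norml => /andP[w1 _] /andP[w2 _].
by rewrite !(le_trans MN).
Qed.


End plane.

(** * Primitives of integrable functions *)

Section cumulative.
Context {R : realType}.
Implicit Types (f phi psi : R * R -> R).

Local Notation plane := (measurableTypeR R * measurableTypeR R)%type.
Local Notation mu := (@lebesgue_measure R).
Local Notation mu2 := (@lebesgue_measure R \x @lebesgue_measure R)%E.

Lemma integrable_mull d (T : measurableType d) (m : {measure set T -> \bar R})
    (f h : T -> R) (C : R) : m.-integrable setT (EFin \o f) ->
  measurable_fun setT h -> (forall x, `|h x| <= C) ->
  m.-integrable setT (EFin \o (fun x => h x * f x)).
Proof.
move=> intf mh hC.
rewrite (_ : _ \o _ = (EFin \o h) \* (EFin \o f))%E; last first.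
  by apply/funext => x /=; rewrite EFinM.
apply: integrableMr => //; exists C; split; first exact: num_real.
by move=> N CN x _ /=; exact: le_trans (hC x) (ltW CN).
Qed.

Lemma measurable_bool_natr d (T : measurableType d) (b : T -> bool) :
  measurable_fun setT b -> measurable_fun setT (fun x => (b x)%:R : R).
Proof.
move=> mb; rewrite (_ : (fun _ => _) = \1_[set x | b x])//.
  apply: measurable_indic; have := mb measurableT [set true] I.
  by rewrite setTI.
apply/funext => x; rewrite indicE.
by have -> : (x \in [set x | b x]) = b x by apply/idP/idP; rewrite inE.
Qed.

Lemma norm_bool_le1 (b : bool) : `|b%:R : R| <= 1.
Proof. by case: b; rewrite ?normr1 ?normr0. Qed.

Definition le2e (w : R * R) (z : \bar R * \bar R) : bool :=
  (w.1%:E <= z.1)%E && (w.2%:E <= z.2)%E.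

Lemma measurable_le2e (z : \bar R * \bar R) : measurable_fun [set: plane] (fun w => le2e w z).
Proof.
apply: measurable_and; apply: measurable_fun_lee.
- by apply: (@measurableT_comp _ _ _ _ _ _ EFin) => //; exact: measurable_fst.
- exact: measurable_cst.
- by apply: (@measurableT_comp _ _ _ _ _ _ EFin) => //; exact: measurable_snd.
- exact: measurable_cst.
Qed.

Lemma measurable_le2 :
  measurable_fun [set: plane * plane] (fun p => le2 p.1 p.2).
Proof.
apply: measurable_and; apply: measurable_fun_ler.
- exact: (measurableT_comp measurable_fst measurable_fst).
- exact: (measurableT_comp measurable_fst measurable_snd).
- exact: (measurableT_comp measurable_snd measurable_fst).
- exact: (measurableT_comp measurable_snd measurable_snd).
Qed.

(** The primitive of an integrable function: its integral over the quadrant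
below z, where z may have infinite coordinates. *)
Definition cumul f (z : \bar R * \bar R) : R :=
  (\int[mu2]_w ((le2e w z)%:R * f w))%R.

Lemma integrable_cumul f (z : \bar R * \bar R) : mu2.-integrable setT (EFin \o f) ->
  mu2.-integrable setT (EFin \o (fun w => (le2e w z)%:R * f w)).
Proof.
move=> intf; apply: (integrable_mull (C := 1)) => //.
  by apply: measurable_bool_natr; exact: measurable_le2e.
by move=> w; exact: norm_bool_le1.
Qed.

(** Dominated convergence speaks of sequences, whereas continuity on the extended
plane is stated with neighbourhoods; countable bases of balls link the two. *)
Lemma seq_continuous (T : pseudoMetricType R) (F : T -> R) (z : T) :
  (forall u : nat -> T, (forall n, ball z n.+1%:R^-1 (u n)) ->
     F (u n) @[n --> \oo] --> F z) -> {for z, continuous F}.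
Proof.
move=> Fu; apply/cvgrPdist_lt => e e0; apply: contrapT => nF.
have bad n : exists w, ball z (n.+1%:R^-1 : R) w /\ ~ (`|F z - F w| < e).
  apply: contrapT => nw; apply: nF; apply/nbhs_ballP.
  exists (n.+1%:R^-1) => //= w zw; apply: contrapT => Fw; apply: nw.
  by exists w.
have [u zu] := choice bad.
have /cvgrPdist_lt/(_ e e0)[N _ /(_ N (leqnn N))] := Fu u (fun n => (zu n).1).
exact: (zu N).2.
Qed.

(** The metric of the extended line is that of the compactified coordinate, which
is increasing: a point other than the limit ends up on the same side of the
sequence as of its limit. *)
Lemma ereal_ball_le_near (x : R) (a : \bar R) (u : nat -> \bar R) : x%:E != a ->
  (forall n, ball a (n.+1%:R^-1 : R) (u n)) ->
  \forall n \near \oo, (x%:E <= u n)%E = (x%:E <= a)%E.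
Proof.
move=> xa au; pose d := `|contract x%:E - contract a|.
have d0 : 0 < d.
  by rewrite normr_gt0 subr_eq0; apply: contra xa => /eqP/(can_inj (@contractK _))->.
near=> n.
have : `|contract a - contract (u n)| < d.
  apply: (lt_trans (au n)); near: n.
  exact: near_infty_natSinv_lt (PosNum d0).
rewrite -(le_contract x%:E (u n)) -(le_contract x%:E a) /d ltr_norml => /andP[].
have [xa'|xa'] := leP (contract x%:E) (contract a).
  by rewrite ler0_norm ?subr_le0// => h1 h2; apply/idP; lra.
by rewrite gtr0_norm ?subr_gt0// => h1 h2; apply/negbTE; rewrite -ltNge; lra.
Unshelve. all: by end_near. Qed.

Lemma line_null (a : \bar R) :
  mu2 [set w | w.1%:E = a] = 0%E /\ mu2 [set w | w.2%:E = a] = 0%E.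
Proof.
case: a => [r||]; last 2 first.
- rewrite (_ : [set w | w.1%:E = +oo%E] = set0); last by apply/seteqP; split=> w.
  rewrite (_ : [set w | w.2%:E = +oo%E] = set0); last by apply/seteqP; split=> w.
  by rewrite !measure0.
- rewrite (_ : [set w | w.1%:E = -oo%E] = set0); last by apply/seteqP; split=> w.
  rewrite (_ : [set w | w.2%:E = -oo%E] = set0); last by apply/seteqP; split=> w.
  by rewrite !measure0.
rewrite (_ : [set w | w.1%:E = r%:E] = [set r] `*` setT); last first.
  by apply/seteqP; split=> [[x y] /= [->]//|[x y] /= [->]].
rewrite (_ : [set w | w.2%:E = r%:E] = setT `*` [set r]); last first.
  by apply/seteqP; split=> [[x y] /= [->]//|[x y] /= [_ ->]].
split; rewrite product_measure1E//.
- by rewrite [X in (X * _)%E]lebesgue_measure_set1 mul0e.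
- by rewrite [X in (_ * X)%E]lebesgue_measure_set1 mule0.
Qed.

Lemma measurable_EFin_preimage1 (a : \bar R) :
  @measurable _ (measurableTypeR R) (EFin @^-1` [set a]).
Proof.
case: a => [r||].
- rewrite (_ : _ @^-1` _ = [set r]); first exact: measurable_set1.
  by apply/seteqP; split=> [x [->]//|x /= ->].
- by rewrite (_ : _ @^-1` _ = set0)//; apply/seteqP; split.
- by rewrite (_ : _ @^-1` _ = set0)//; apply/seteqP; split.
Qed.

Lemma ae_off_lines (a : \bar R * \bar R) :
  {ae mu2, forall w, w.1%:E <> a.1 /\ w.2%:E <> a.2}.
Proof.
have [m1 n1] : @measurable _ plane [set w | w.1%:E = a.1] /\
    @measurable _ plane [set w | w.2%:E = a.2].
  split.
    rewrite (_ : [set w | w.1%:E = a.1] = fst @^-1` (EFin @^-1` [set a.1])) //.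
    rewrite -[X in measurable X]setTI; apply: measurable_fst => //.
    exact: measurable_EFin_preimage1.
  rewrite (_ : [set w | w.2%:E = a.2] = snd @^-1` (EFin @^-1` [set a.2])) //.
  rewrite -[X in measurable X]setTI; apply: measurable_snd => //.
  exact: measurable_EFin_preimage1.
have h1 : {ae mu2, forall w, w.1%:E <> a.1}.
  exists [set w | w.1%:E = a.1]; split=> //; first exact: (line_null a.1).1.
  by move=> w /= /contrapT.
have h2 : {ae mu2, forall w, w.2%:E <> a.2}.
  exists [set w | w.2%:E = a.2]; split=> //; first exact: (line_null a.2).2.
  by move=> w /= /contrapT.
apply: (negligibleS _ (negligibleU h1 h2)) => w /= /not_andP[w1|w2].
  by left.
by right.
Qed.

(** When z_n tends to z, the indicators of the quadrants below z_n converge to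
that of the quadrant below z off the two lines through z, which are null sets.
Dominated convergence, with dominating function |f|, concludes. *)
Lemma cumul_continuous f : mu2.-integrable setT (EFin \o f) ->
  continuous (cumul f).
Proof.
move=> intf z; apply: seq_continuous => u zu.
have intfu w := integrable_cumul w intf.
pose f_ n (w : plane) := ((le2e w (u n))%:R * f w)%:E.
pose f0 (w : plane) := ((le2e w z)%:R * f w)%:E.
have [|||||_ _ cvgf] := @dominated_convergence _ plane R mu2 setT measurableT
    f_ f0 (EFin \o (Num.norm \o f)).
- by move=> n; case/integrableP : (intfu (u n)).
- by case/integrableP : (intfu z).
- apply: negligibleS (ae_off_lines z) => w /=; apply: contra_not.
  move=> [/eqP w1 /eqP w2] _.
  apply: cvg_near_cst; near=> n; rewrite /f_ /f0 /le2e; congr ((_ && _)%:R * _)%:E.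
    near: n; apply: ereal_ball_le_near => // n; exact: (zu n).1.
  near: n; apply: ereal_ball_le_near => // n; exact: (zu n).2.
- exact: integrable_norm.
- exists set0; split; [exact: measurable0|exact: measure0|].
  move=> w /=; apply => n _; rewrite lee_fin normrM ler_piMl// norm_bool_le1//.
apply: fine_cvg; rewrite fineK//.
by apply: integrable_fin_num => //; exact: (intfu z).
Unshelve. all: by end_near. Qed.

Lemma cumul_Bc f : mu2.-integrable setT (EFin \o f) -> Bc (cumul f).
Proof.
move=> intf; split; first exact: cumul_continuous.
have le2e0 (w : R * R) (z : \bar R * \bar R) : z.1 = -oo%E \/ z.2 = -oo%E ->
      le2e w z = false.
  by rewrite /le2e => -[->|->]; rewrite leeNy_eq/= ?andbF.
by move=> s; split; rewrite /cumul /Rintegral integral0_eq// => w _;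
  rewrite le2e0 ?mul0r//=; [left|right].
Qed.

Lemma d12E (T : testfun R -> R) (phi : testfun R) :
  d12 T phi = T (test_partial true (test_partial false phi)).
Proof. exact: opprK. Qed.

Lemma test_smooth (phi : testfun R) : smooth phi.
Proof. by have /test_predP[] := test_valP phi. Qed.

Lemma test_continuous (phi : testfun R) : continuous phi.
Proof. exact: (test_smooth phi [::]).1. Qed.

Lemma vanishes_offW (M N : R) phi : M <= N -> vanishes_off M phi -> vanishes_off N phi.
Proof.
by move=> MN v z [|] /(le_lt_trans MN) Mz; apply: v; [left|right].
Qed.

Lemma test_vanishes_off (phi : testfun R) : exists M, vanishes_off M phi.
Proof.
by have /test_predP[_ /compact_supp_vanishes_off[M _ v]] := test_valP phi; exists M.
Qed.

Lemma test_integrable (phi : testfun R) : mu2.-integrable setT (EFin \o phi).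
Proof.
have [M v] := test_vanishes_off phi.
by apply: integrable_vanishes_off v; exact: test_continuous.
Qed.

Lemma test_bounded (phi : testfun R) : exists2 C, 0 <= C & forall z, `|phi z| <= C.
Proof.
have [M v] := test_vanishes_off phi.
by apply: bounded_vanishes_off v; exact: test_continuous.
Qed.

Lemma test_measurable (phi : testfun R) : measurable_fun [set: plane] phi.
Proof. by apply: continuous_measurable_plane; exact: test_continuous. Qed.

Lemma test_upper_quadrant (phi : testfun R) z :
  (\int[mu2]_w ((le2 z w)%:R * test_partial true (test_partial false phi) w)%:E =
   (phi z)%:E)%E.
Proof.
have [M1 v1] := test_vanishes_off phi.
have [M2 v2] := test_vanishes_off (test_partial true (test_partial false phi)).
apply: (integral_upper_quadrant (M := Num.max M1 M2)).
- exact: test_smooth.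
- by apply: vanishes_offW v1; rewrite le_max lexx.
- by apply: vanishes_offW v2; rewrite le_max lexx orbT.
Qed.

Lemma integrable_tensor d1 d2 (T1 : measurableType d1) (T2 : measurableType d2)
    (m1 : {sigma_finite_measure set T1 -> \bar R})
    (m2 : {sigma_finite_measure set T2 -> \bar R}) (f : T1 -> R) (g : T2 -> R) :
  m1.-integrable setT (EFin \o f) -> m2.-integrable setT (EFin \o g) ->
  (m1 \x m2)%E.-integrable setT (EFin \o (fun p : T1 * T2 => f p.1 * g p.2)).
Proof.
move=> intf intg.
have mf : measurable_fun setT f by apply/measurable_EFinP; case/integrableP : intf.
have mg : measurable_fun setT g by apply/measurable_EFinP; case/integrableP : intg.
apply/integrable12ltyP.
  apply/measurable_EFinP; apply: measurable_funM.
    exact: measurableT_comp mf measurable_fst.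
  exact: measurableT_comp mg measurable_snd.
pose K := (\int[m2]_w `|(g w)%:E|)%E.
have K0 : (0 <= K)%E by exact: integral_ge0.
have Kfin : K \is a fin_num by rewrite ge0_fin_numE//; case/integrableP : intg.
rewrite (_ : (\int[m1]_x _)%E = (\int[m1]_x (`|(f x)%:E| * K))%E); last first.
  apply: eq_integral => z _; rewrite /= -ge0_integralZl//=.
  - by apply: eq_integral => w _; rewrite normrM EFinM.
  - by apply/measurable_EFinP; exact: measurableT_comp.
rewrite ge0_integralZr//=; last by apply/measurable_EFinP; exact: measurableT_comp.
case/integrableP : intf => _ intf.
by rewrite muleC lte_mul_pinfty.
Qed.

(** A name for the product measure that carries its sigma-finiteness, which is
needed to apply Fubini's theorem to pairs of points of the plane. *)
Definition plane_measure : set plane -> \bar R := mu2.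

HB.instance Definition _ := Measure.copy plane_measure mu2.

Lemma plane_measure_sigma_finite : sigma_finite setT plane_measure.
Proof.
exists (fun n => rect (- n%:R) n%:R (- n%:R) n%:R) => [|n].
  apply/seteqP; split=> // z _.
  have [N1 z1] : exists n : nat, `|z.1| <= n%:R.
    by exists (Num.bound `|z.1|); apply/ltW/archi_boundP; exact: normr_ge0.
  have [N2 z2] : exists n : nat, `|z.2| <= n%:R.
    by exists (Num.bound `|z.2|); apply/ltW/archi_boundP; exact: normr_ge0.
  exists (N1 + N2)%N => //; split; rewrite /= in_itv/= -ler_norml.
    by rewrite (le_trans z1)// ler_nat leq_addr.
  by rewrite (le_trans z2)// ler_nat leq_addl.
by split; [exact: measurable_rect|exact: rect_finite].
Qed.

HB.instance Definition _ := Measure_isSigmaFinite.Build _ _ _ plane_measure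
  plane_measure_sigma_finite.

(** The two iterated integrals of f(z) 1[z <= w] d12 phi(w) over pairs of points
of the plane: integrating in w first gives f phi by [test_upper_quadrant],
integrating in z first gives the primitive of f against d12 phi. *)
Lemma cumul_by_parts f (phi : testfun R) : mu2.-integrable setT (EFin \o f) ->
  regular_distr f phi = d12 (regular_distr (restrict_plane (cumul f))) phi.
Proof.
move=> intf; rewrite d12E /regular_distr.
set psi := test_partial true (test_partial false phi).
pose k (p : plane * plane) : R := (le2 p.1 p.2)%:R * (f p.1 * psi p.2).
have intk : (plane_measure \x plane_measure)%E.-integrable setT (EFin \o k).
  apply: (integrable_mull (C := 1)).
  - apply: (@integrable_tensor _ _ _ _ plane_measure plane_measure) => //.
    exact: test_integrable.
  - by apply: measurable_bool_natr; exact: measurable_le2.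
  - by move=> p; exact: norm_bool_le1.
have h1 z : (\int[plane_measure]_w (k (z, w))%:E = (f z * phi z)%:E)%E.
  rewrite (eq_integral (fun w : plane => (f z)%:E * ((le2 z w)%:R * psi w)%:E)%E);
    last first.
    by move=> w _; rewrite /k/= -EFinM mulrCA.
  rewrite integralZl//; first by rewrite [X in (_ * X)%E]test_upper_quadrant EFinM.
  apply: (integrable_mull (C := 1)); first exact: test_integrable.
    apply: measurable_bool_natr.
    exact: (measurableT_comp measurable_le2 (pair1_measurable z)).
  by move=> p; exact: norm_bool_le1.
have h2 w : (\int[plane_measure]_z (k (z, w))%:E =
    (restrict_plane (cumul f) w * psi w)%:E)%E.
  rewrite (eq_integral (fun z : plane => ((le2 z w)%:R * f z)%:E * (psi w)%:E)%E);
    last first.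
    by move=> z _; rewrite /k/= -EFinM mulrA.
  have intfw := integrable_cumul (w.1%:E, w.2%:E) intf.
  rewrite integralZr// EFinM; congr (_ * _)%E; rewrite fineK//.
  exact: integrable_fin_num.
rewrite /Rintegral; congr fine.
rewrite (eq_integral _ _ (fun z _ => esym (h1 z))).
rewrite [RHS](eq_integral _ _ (fun z _ => esym (h2 z))).
exact: (Fubini intk).
Qed.

Lemma regular_distr_integrable f (phi : testfun R) :
  mu2.-integrable setT (EFin \o f) ->
  mu2.-integrable setT (EFin \o (fun z => f z * phi z)).
Proof.
move=> intf; have [C _ phiC] := test_bounded phi.
rewrite (_ : (fun _ => _) = fun z => phi z * f z).
  by apply: (integrable_mull (C := C)) => //; exact: test_measurable.
by apply/funext => z; rewrite mulrC.
Qed.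

(** Sequential continuity only uses uniform convergence of the test functions
themselves, since f has a finite integral. *)
Lemma regular_distr_distributions f : mu2.-integrable setT (EFin \o f) ->
  distributions (regular_distr f).
Proof.
move=> intf; split=> [a phi psi|phi_ phi [_ /(_ [::]) cvgphi]].
  rewrite /regular_distr -RintegralZl//; last exact: regular_distr_integrable.
  rewrite -RintegralD//; last exact: regular_distr_integrable.
    by apply: eq_Rintegral => z _; rewrite mulrDr mulrCA.
  rewrite (_ : (fun _ => _) = fun z => f z * (a *: phi) z).
    exact: regular_distr_integrable.
  by apply/funext => z; rewrite mulrCA.
have near_phi d : 0 < d -> \forall n \near \oo, forall z, `|phi z - phi_ n z| < d.
  move=> d0; apply: (cvgphi [set g | forall z, `|phi z - g z| < d]).
  apply/uniform_nbhs; exists [set xy | ball xy.1 d xy.2]; split.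
    exact: entourage_ball (PosNum d0).
  by move=> g /= gd z; exact: gd.
pose K := (\int[mu2]_z `|f z|)%R.
have K0 : 0 <= K by exact: Rintegral_ge0.
have intnf : mu2.-integrable setT (EFin \o (fun z => `|f z|)) by exact: integrable_norm.
apply/cvgrPdist_lt => e e0.
(* K may vanish, hence the denominator K + 1 *)
have d0 : 0 < e / (K + 1) by rewrite divr_gt0// ltr_wpDl.
apply: filterS (near_phi _ d0) => n phin.
have i1 := regular_distr_integrable phi intf.
have i2 := regular_distr_integrable (phi_ n) intf.
rewrite /regular_distr -RintegralB//.
have i12 := integrableB measurableT i1 i2.
apply: (le_lt_trans (le_normr_Rintegral _ i12)) => //.
apply: (@le_lt_trans _ _ (\int[mu2]_z (e / (K + 1) * `|f z|))%R).
  apply: le_Rintegral => //.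
  - exact: integrable_norm.
  - apply: (integrable_mull (C := e / (K + 1))) => //.
    by move=> z; rewrite gtr0_norm.
  - by move=> z _; rewrite -mulrBr normrM mulrC ler_wpM2r// ltW.
rewrite RintegralZl// -/K mulrAC ltr_pdivrMr ?ltr_wpDl//.
by rewrite mulrDr mulr1 ltrDl.
Qed.

Lemma L1_distr_Ac : @L1_distr R `<=` @Ac R.
Proof.
move=> _ [f /= intf <-]; split; first exact: regular_distr_distributions.
exists (cumul f); split; first exact: cumul_Bc.
by apply/funext => phi; exact: cumul_by_parts.
Qed.

End cumulative.

(** * Uniqueness of primitives *)

Section uniqueness.
Context {R : realType}.
Implicit Types (F G H : \bar R * \bar R -> R).

Local Notation plane := (measurableTypeR R * measurableTypeR R)%type.
Local Notation mu2 := (@lebesgue_measure R \x @lebesgue_measure R)%E.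

Lemma continuous_EFin2 : continuous (fun z : R * R => (z.1%:E, z.2%:E)).
Proof.
move=> z; apply: (cvg_pair (F := nbhs z) (G := nbhs z.1%:E) (H := nbhs z.2%:E)).
  by move=> A /nbhs_EFin; exact: cvg_fst.
by move=> A /nbhs_EFin; exact: cvg_snd.
Qed.

Lemma restrict_plane_continuous F : continuous F -> continuous (restrict_plane F).
Proof. by move=> cF z; apply: continuous_comp; [exact: continuous_EFin2|exact: cF]. Qed.

Lemma integrable_restrict_plane F (phi : testfun R) : continuous F ->
  mu2.-integrable setT (EFin \o (fun z => restrict_plane F z * phi z)).
Proof.
move=> cF; have [M v] := test_vanishes_off phi.
apply: (@integrable_vanishes_off _ M).
  by move=> z; apply: cvgM; [exact: restrict_plane_continuous|exact: test_continuous].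
by move=> z zM; rewrite v// mulr0.
Qed.

Lemma d12_regular_distrB F G : continuous F -> continuous G ->
  d12 (regular_distr (restrict_plane (F - G))) =
  d12 (regular_distr (restrict_plane F)) - d12 (regular_distr (restrict_plane G)).
Proof.
move=> cF cG; apply/funext => phi; 
rewrite -[RHS]/(d12 (regular_distr (restrict_plane F)) phi -
  d12 (regular_distr (restrict_plane G)) phi) !d12E /regular_distr.
rewrite -RintegralB//; try exact: integrable_restrict_plane.
by apply: eq_Rintegral => z _; rewrite -mulrBl.
Qed.

Lemma vanishes_off_test (M : R) (phi : R * R -> R) : smooth phi ->
  vanishes_off M phi -> phi \in test_pred.
Proof.
move=> sphi v; apply/test_predP; split => //.
have cM := @compact_rect R (- M) M (- M) M.
apply: (subclosed_compact _ cM); first exact: closed_closure.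
rewrite [X in _ `<=` X](closure_id _).1; last first.
  by apply: compact_closed cM; exact: norm_hausdorff.
apply: closureS => z /=; rewrite -(vanishes_off_rect v) patchE.
by case: ifPn => [|_]; rewrite ?eqxx// inE.
Qed.

Lemma vanishes_off_tensor (M : R) (f g : R -> R) :
  (forall x, M < `|x| -> f x = 0) -> (forall x, M < `|x| -> g x = 0) ->
  vanishes_off M (tensor f g).
Proof. by move=> f0 g0 z [/f0|/g0] h; rewrite /tensor h ?mul0r ?mulr0. Qed.

(** The derivatives of two ramps form a probability density carried by the
rectangle on which the ramps climb: its total mass is the rectangular increment
of the product of the ramps. *)
Section average.
Variables (u1 v1 u2 v2 : R) (uv1 : u1 < v1) (uv2 : u2 < v2).
Let weight := tensor (derive1 (ramp u1 v1)) (derive1 (ramp u2 v2)).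

Lemma weight_ge0 z : 0 <= weight z.
Proof. by rewrite mulr_ge0// ramp_derive1_ge0. Qed.

Lemma weight_continuous : continuous weight.
Proof.
by have [] := smooth_tensor (elem_derive1 (elem_ramp u1 v1))
  (elem_derive1 (elem_ramp u2 v2)) [::].
Qed.

Lemma weight_off_rect z : z \notin rect u1 v1 u2 v2 -> weight z = 0.
Proof.
rewrite in_rect !negb_and -!ltNge /weight /tensor.
case/or4P => h.
- by rewrite (ramp_derive1_lt uv1 h) mul0r.
- by rewrite (ramp_derive1_gt uv1 h) mul0r.
- by rewrite (ramp_derive1_lt uv2 h) mulr0.
- by rewrite (ramp_derive1_gt uv2 h) mulr0.
Qed.

Lemma weight_patch (h : R * R -> R) : (fun z => h z * weight z) =
  (fun z => h z * weight z) \_ (rect u1 v1 u2 v2).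
Proof.
by apply/funext => z; rewrite patchE; case: ifPn => // /weight_off_rect->; rewrite mulr0.
Qed.

Lemma integrable_weight (h : R * R -> R) : continuous h ->
  mu2.-integrable setT (EFin \o (fun z => h z * weight z)).
Proof.
move=> ch; rewrite weight_patch -restrict_EFin.
apply: (integrable_restrict _ (@measurable_rect _ _ _ _ _) measurableT _).1.
rewrite setTI; apply: integrable_rect => z.
by apply: cvgM; [exact: ch|exact: weight_continuous].
Qed.

Lemma integral_weight : (\int[mu2]_z weight z = 1)%R.
Proof.
rewrite /Rintegral (@integral_eq_rect _ (partials [:: true; false]
  (tensor (ramp u1 v1) (ramp u2 v2))) _ u1 v1 u2 v2) => [|z]; last first.
  rewrite d12_tensor; try exact: elem_ramp.
  by case: (boolP (z \in _)) => [|/weight_off_rect] zr; rewrite ?mul1r// mul0r.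
rewrite integral_rect_d12 ?(ltW uv1) ?(ltW uv2)//; last first.
  by apply: smooth_tensor; exact: elem_ramp.
rewrite /tensor /= (ramp_ge uv1 (lexx _)) (ramp_ge uv2 (lexx _)).
rewrite (ramp_le uv1 (lexx _)) (ramp_le uv2 (lexx _)).
by rewrite !(mul0r, mulr0, mulr1, subr0).
Qed.

(** Since the weight has mass 1, the difference is the integral of h - c against
it. *)
Lemma average_close (h : R * R -> R) (c eta : R) : continuous h ->
  (forall z, z \in rect u1 v1 u2 v2 -> `|h z - c| <= eta) ->
  `|(\int[mu2]_z (h z * weight z))%R - c| <= eta.
Proof.
move=> ch hc.
have cc (r : R) : continuous (fun _ : R * R => r).
  by move=> z; exact: cvg_cst.
have ic r := integrable_weight (cc r).
have i1 := integrable_weight ch.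
have int_cst r : (\int[mu2]_z (r * weight z))%R = r.
  rewrite RintegralZl ?integral_weight ?mulr1//.
  by have := ic 1; under eq_fun do rewrite mul1r.
rewrite -{1}(int_cst c) -RintegralB//.
have ib := integrableB measurableT i1 (ic c).
apply: (le_trans (le_normr_Rintegral _ ib)) => //.
rewrite -[leRHS](int_cst eta); apply: le_Rintegral => //.
  exact: (integrable_norm ib).
move=> z _; rewrite -mulrBl normrM (ger0_norm (weight_ge0 z)).
have [zr|/weight_off_rect->] := boolP (z \in rect u1 v1 u2 v2).
  by rewrite ler_wpM2r ?weight_ge0 ?hc.
by rewrite !mulr0.
Qed.

End average.

(** The real plane is thus dense in the extended plane, and the averages over
real rectangles reach the values of F at infinity as well. *)
Lemma nbhs_ereal_segment (a : \bar R) (A : set (\bar R)) : nbhs a A ->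
  exists u v : R, u < v /\ forall x, u <= x <= v -> A x%:E.
Proof.
case: a => [r||].
- move=> /nbhs_EFin/nbhs_ballP[e /= e0 rA]; exists r, (r + e / 2).
  split=> [|x /andP[rx xr]]; first lra.
  by apply: rA; rewrite /ball/= ltr_norml; lra.
- move=> /nbhs_ereal_pinfty[_ [M [_ MA]]]; exists (M + 1), (M + 2).
  by split=> [|x /andP[xM _]]; [lra|apply: MA; lra].
- move=> /nbhs_ereal_ninfty[_ [M [_ MA]]]; exists (M - 2), (M - 1).
  by split=> [|x /andP[_ xM]]; [lra|apply: MA; lra].
Qed.

Lemma continuous_box F (a b : \bar R) (eta : R) : continuous F -> 0 < eta ->
  exists A B, [/\ nbhs a A, nbhs b B &
    forall x y, A x -> B y -> `|F (x, y) - F (a, b)| <= eta].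
Proof.
move=> cF eta0; have /cvgrPdist_le/(_ eta eta0)[[A B] /= [aA bB] AB] := cF (a, b).
by exists A, B; split=> // x y Ax By; rewrite distrC; apply: (AB (x, y)).
Qed.

Lemma le_dense_real F (c : R) : continuous F ->
  (forall z, `|restrict_plane F z| <= c) -> forall z, `|F z| <= c.
Proof.
move=> cF Fc [a b]; apply/ler_addgt0Pr => e e0.
have [A [B [aA bB AB]]] := continuous_box a b cF e0.
have [u1 [v1 [uv1 A1]]] := nbhs_ereal_segment aA.
have [u2 [v2 [uv2 B2]]] := nbhs_ereal_segment bB.
have /AB/(_ (B2 u2 _)) := A1 u1 ltac:(by rewrite lexx ltW).
rewrite lexx ltW// => /(_ isT) h.
have := Fc (u1, u2); rewrite /restrict_plane/= => h2.
rewrite -(subrK (F (u1%:E, u2%:E)) (F (a, b))) (le_trans (ler_normD _ _))//.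
by rewrite addrC lerD// distrC.
Qed.

(** A difference of two ramps has compact support, and its derivative is the
difference of two probability densities. *)
Definition bump (u v u' v' x : R) : R := -1 * ramp u' v' x + ramp u v x.

Lemma elem_bump u v u' v' : elementary (bump u v u' v').
Proof. by apply: elem_lin; exact: elem_ramp. Qed.

Lemma bump_eq0 u v u' v' x : u < v -> u' < v' ->
  Num.max (Num.max `|u| `|v|) (Num.max `|u'| `|v'|) < `|x| -> bump u v u' v' x = 0.
Proof.
move=> uv uv'; rewrite !gt_max => /andP[/andP[h1 h2] /andP[h3 h4]].
rewrite /bump; have [x0|x0] := leP 0 x.
  rewrite (ger0_norm x0) in h1 h2 h3 h4.
  rewrite !ramp_ge ?mulN1r ?addNr//.
    exact: le_trans (ler_norm _) (ltW h2).
  exact: le_trans (ler_norm _) (ltW h4).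
rewrite (ltr0_norm x0) in h1 h2 h3 h4.
have lx (y : R) : `|y| < - x -> x <= y by rewrite ltr_norml opprK => /andP[/ltW].
by rewrite !ramp_le ?mulr0 ?addr0//; exact: lx.
Qed.

Lemma derive1_bump u v u' v' x :
  derive1 (bump u v u' v') x = derive1 (ramp u v) x - derive1 (ramp u' v') x.
Proof.
rewrite derive1_lin ?mulN1r 1?addrC//; apply: elem_derivable; exact: elem_ramp.
Qed.

Lemma mul_subsub (h a a' b b' : R) : h * ((a - a') * (b - b')) =
  h * (a * b) - h * (a * b') - (h * (a' * b) - h * (a' * b')).
Proof. by ring. Qed.

Lemma four_averages (eta c x00 x01 x10 x11 : R) :
  `|x00 - c| <= eta -> `|x01| <= eta -> `|x10| <= eta -> `|x11| <= eta ->
  x00 = x01 + x10 - x11 -> `|c| <= eta *+ 4.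
Proof.
rewrite !ler_norml => /andP[? ?] /andP[? ?] /andP[? ?] /andP[? ?] ?.
by apply/andP; split; rewrite -mulr_natr; lra.
Qed.

(** Testing against the tensor product of two bumps expresses the average of F
over a small rectangle near (a, b) by its averages over three rectangles near
(a, -oo), (-oo, b) and (-oo, -oo), where F is close to 0. *)
Lemma Bc_unique_point F (a b : \bar R) (eta : R) : Bc F -> 0 < eta ->
  (forall phi, d12 (regular_distr (restrict_plane F)) phi = 0) ->
  `|F (a, b)| <= eta *+ 4.
Proof.
move=> [cF F0] eta0 TF.
have [A00 [B00 [nA00 nB00 F00]]] := continuous_box a b cF eta0.
have [A01 [B01 [nA01 nB01 F01]]] := continuous_box a -oo%E cF eta0.
have [A10 [B10 [nA10 nB10 F10]]] := continuous_box -oo%E b cF eta0.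
have [A11 [B11 [nA11 nB11 F11]]] := continuous_box -oo%E -oo%E cF eta0.
have [u0 [v0 [uv0 A0]]] := nbhs_ereal_segment (filterI nA00 nA01).
have [u1 [v1 [uv1 A1]]] := nbhs_ereal_segment (filterI nA10 nA11).
have [s0 [t0 [st0 B0]]] := nbhs_ereal_segment (filterI nB00 nB10).
have [s1 [t1 [st1 B1]]] := nbhs_ereal_segment (filterI nB01 nB11).
have cf := restrict_plane_continuous cF.
pose I u v s t := (\int[mu2]_z (restrict_plane F z *
  tensor (derive1 (ramp u v)) (derive1 (ramp s t)) z))%R.
have F1 s : F (s, -oo%E) = 0 by have [] := F0 s.
have F2 s : F (-oo%E, s) = 0 by have [] := F0 s.
have I00 : `|I u0 v0 s0 t0 - F (a, b)| <= eta.
  apply: average_close => // z; rewrite in_rect => /and4P[z1 z2 z3 z4].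
  by apply: F00; [apply: (A0 _ _).1|apply: (B0 _ _).1]; exact/andP.
have I01 : `|I u0 v0 s1 t1| <= eta.
  rewrite -[I _ _ _ _]subr0 -(F1 a).
  apply: average_close => // z; rewrite in_rect => /and4P[z1 z2 z3 z4].
  by apply: F01; [apply: (A0 _ _).2|apply: (B1 _ _).1]; exact/andP.
have I10 : `|I u1 v1 s0 t0| <= eta.
  rewrite -[I _ _ _ _]subr0 -(F2 b).
  apply: average_close => // z; rewrite in_rect => /and4P[z1 z2 z3 z4].
  by apply: F10; [apply: (A1 _ _).1|apply: (B0 _ _).2]; exact/andP.
have I11 : `|I u1 v1 s1 t1| <= eta.
  rewrite -[I _ _ _ _]subr0 -(F2 -oo%E).
  apply: average_close => // z; rewrite in_rect => /and4P[z1 z2 z3 z4].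
  by apply: F11; [apply: (A1 _ _).2|apply: (B1 _ _).2]; exact/andP.
suff E : I u0 v0 s0 t0 = I u0 v0 s1 t1 + I u1 v1 s0 t0 - I u1 v1 s1 t1.
  exact: four_averages I00 I01 I10 I11 E.
(* [-M, M] and [-N, N] contain the supports of the two bumps used below *)
pose M := Num.max (Num.max `|u0| `|v0|) (Num.max `|u1| `|v1|).
pose N := Num.max (Num.max `|s0| `|t0|) (Num.max `|s1| `|t1|).
have ht : tensor (bump u0 v0 u1 v1) (bump s0 t0 s1 t1) \in test_pred.
  apply: (@vanishes_off_test (Num.max M N)); first by apply: smooth_tensor; exact: elem_bump.
  apply: vanishes_off_tensor => x; rewrite gt_max => /andP[? ?];
    exact: bump_eq0.
have := TF (TestFun ht); rewrite d12E /regular_distr.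
have -> : (test_partial true (test_partial false (TestFun ht)) : R * R -> R) =
    tensor (derive1 (bump u0 v0 u1 v1)) (derive1 (bump s0 t0 s1 t1)).
  by apply: d12_tensor; exact: elem_bump.
pose w u v s t z := restrict_plane F z *
  tensor (derive1 (ramp u v)) (derive1 (ramp s t)) z.
have iw u v s t : u < v -> s < t -> mu2.-integrable setT (EFin \o w u v s t).
  by move=> uv st; exact: integrable_weight.
rewrite (@eq_Rintegral _ _ _ _ _ (fun z : plane => (w u0 v0 s0 t0 z - w u0 v0 s1 t1 z) -
    (w u1 v1 s0 t0 z - w u1 v1 s1 t1 z))); last first.
  by move=> z _; rewrite /w /tensor !derive1_bump; exact: mul_subsub.
have i0 := integrableB measurableT (iw _ _ _ _ uv0 st0) (iw _ _ _ _ uv0 st1).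
have i1 := integrableB measurableT (iw _ _ _ _ uv1 st0) (iw _ _ _ _ uv1 st1).
have e0 := RintegralB measurableT (iw _ _ _ _ uv0 st0) (iw _ _ _ _ uv0 st1).
have e1 := RintegralB measurableT (iw _ _ _ _ uv1 st0) (iw _ _ _ _ uv1 st1).
have e01 := etrans (RintegralB measurableT i0 i1) (congr2 (fun x y => x - y) e0 e1).
move=> /(etrans (esym e01)).
rewrite -[X in X = 0]/((I u0 v0 s0 t0 - I u0 v0 s1 t1) -
  (I u1 v1 s0 t0 - I u1 v1 s1 t1)).
move: (I u0 v0 s0 t0) (I u0 v0 s1 t1) (I u1 v1 s0 t0) (I u1 v1 s1 t1).
by move=> x00 x01 x10 x11 /eqP; rewrite subr_eq0 subr_eq => /eqP ->; rewrite addrC addrA.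
Qed.

Lemma primitive_unique (T : testfun R -> R) F G :
  primitive_of T F -> primitive_of T G -> F = G.
Proof.
move=> [[cF F0] TF] [[cG G0] TG].
have cFG : continuous (F - G) by move=> z; apply: cvgB; [exact: cF|exact: cG].
have BFG : Bc (F - G).
  split=> // s; have [f1 f2] := F0 s; have [g1 g2] := G0 s.
  by rewrite !fctE f1 f2 g1 g2 subrr.
apply/funext => -[a b]; apply/eqP; rewrite -subr_eq0 -normr_eq0 eq_le normr_ge0 andbT.
apply/ler_addgt0Pr => e e0; rewrite add0r.
have e40 : 0 < e / 4 by rewrite divr_gt0.
apply: (le_trans (Bc_unique_point a b BFG e40 _)).
  by move=> phi; rewrite d12_regular_distrB// -TF -TG; exact: subrr.
by rewrite -[leLHS]mulr_natr divfK ?pnatr_eq0.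
Qed.

End uniqueness.

(** * Approximation by primitives of test functions *)

Section density.
Context {R : realType}.
Implicit Types (F : \bar R * \bar R -> R) (phi psi : R * R -> R).

Local Notation plane := (measurableTypeR R * measurableTypeR R)%type.
Local Notation mu2 := (@lebesgue_measure R \x @lebesgue_measure R)%E.

(** The composite is the retraction of the line onto [-1, 1]. *)
Lemma contract_expand_dist (r s : R) :
  `|contract (expand r) - contract (expand s)| <= `|r - s|.
Proof.
wlog rs : r s / r <= s.
  by move=> h; have [/h//|/ltW/h] := leP r s; rewrite distrC (distrC s).
rewrite distrC (distrC r) !ger0_norm ?subr_ge0 ?le_contract ?le_expand//.
have cl (t : R) : contract (expand t) = if t <= -1 then -1 else if 1 <= t then 1 else t.
  case: ifPn => [t1|]; first by rewrite expandN1.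
  rewrite -ltNge => t1; case: ifPn => [t2|]; first by rewrite expand1.
  by rewrite -ltNge => t2; rewrite expandK// inE ler_norml !ltW.
rewrite !cl; case: (leP r (-1)) => ?; case: (leP 1 r) => ?;
  by case: (leP s (-1)) => ?; case: (leP 1 s) => ?; lra.
Qed.

Lemma continuous_expand : continuous (@expand R).
Proof.
move=> r A /nbhs_ballP[e /= e0 reA]; apply/nbhs_ballP; exists e => //= s rs.
by apply: reA; exact: le_lt_trans (contract_expand_dist r s) rs.
Qed.

(** The extended line is the continuous image of [-1, 1] under [expand]. *)
Lemma compact_ereal2 : compact [set: \bar R * \bar R].
Proof.
have cE : compact [set: \bar R].
  rewrite (_ : [set: \bar R] = @expand R @` `[-1, 1]).
    apply: continuous_compact; last exact: segment_compact.
    exact/continuous_subspaceT/continuous_expand.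
  apply/seteqP; split=> // x _; exists (contract x); last exact: contractK.
  by rewrite /= in_itv/= -ler_norml contract_le1.
by rewrite -setXTT; exact: compact_setX.
Qed.

(** Uniform continuity on a compact space, from the covering by balls of half the
radius of continuity. *)
Lemma Heine_Cantor F e : continuous F -> 0 < e ->
  exists2 d : R, 0 < d & forall z w, ball z d w -> `|F z - F w| <= e.
Proof.
move=> cF e0; have cpt := compact_ereal2.
move/compact_near_coveringP : cpt => /(_ R 0^'+
  (fun d z => forall w, ball z d w -> `|F z - F w| <= e) _) [|d /= d0 dP].
  move=> z _; have /cvgrPdist_le/(_ (e / 2)) := cF z.
  rewrite divr_gt0// => /(_ isT)/nbhs_ballP[d /= d0 zd].
  (* the radius d is halved so that a ball around a nearby point stays inside *)
  exists (ball z (d / 2), [set x : R | x < d / 2]) => /=.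
    split; first by apply: nbhsx_ballx; rewrite divr_gt0.
    by apply: nbhs_right_lt; rewrite divr_gt0.
  move=> [x r] /= [zx rd] w xw.
  have zx' : `|F z - F x| <= e / 2.
    by apply: zd; apply: le_ball zx; rewrite ler_piMr ?ltW// invf_lt1 ?ltr1n.
  have zw : `|F z - F w| <= e / 2.
    apply: zd; rewrite (splitr d); apply: ball_triangle zx _.
    by apply: le_ball xw; exact: ltW.
  rewrite -(subrKA (F z)) (le_trans (ler_normD _ _))// (splitr e) lerD//.
  by rewrite distrC.
exists (d / 2); first by rewrite divr_gt0.
move=> z w; apply: (dP (d / 2)) => //=; last by rewrite divr_gt0.
by rewrite /ball/= sub0r normrN gtr0_norm ?divr_gt0//; lra.
Qed.

(** Equally spaced nodes of the compactified coordinate, with the two endpoints,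
which are infinite, left out: the first and the last cell are unbounded. *)
Lemma grid (d : R) : 0 < d -> exists n (X : nat -> R),
  [/\ forall i, (i < n)%N -> X i < X i.+1,
      forall x, x <= X 0%N -> ball (-oo%E : \bar R) d x%:E,
      forall i x y, (i < n)%N -> X i <= x <= X i.+1 -> X i <= y <= X i.+1 ->
        ball x%:E d y%:E &
      forall x, X n <= x -> ball (X n)%:E d x%:E].
Proof.
move=> d0; have [n nd] : exists n : nat, 2 / n.+2%:R < d.
  exists (Num.bound (2 / d)); rewrite ltr_pdivrMr// mulrC -ltr_pdivrMr//.
  apply: (lt_trans (archi_boundP _)); first by rewrite divr_ge0// ltW.
  by rewrite ltr_nat.
(* mesh of the subdivision of [-1, 1] into n + 2 cells *)
pose s : R := 2 / n.+2%:R; pose c k : R := -1 + k.+1%:R * s.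
have s0 : 0 < s by rewrite divr_gt0.
have cn : c n = 1 - s.
  have N0 : n.+2%:R != 0 :> R by rewrite pnatr_eq0.
  rewrite /c /s (_ : n.+1%:R = n.+2%:R - 1 :> R); last by rewrite -[n.+2%:R]natr1 addrK.
  by move: (n.+2%:R : R) N0 => N N0; field.
have cS k : c k.+1 = c k + s by rewrite /c -[k.+2%:R]natr1 mulrDl mul1r addrA.
have c0 : c 0%N = -1 + s by rewrite /c mul1r.
have ck k : (k <= n)%N -> -1 < c k < 1.
  move=> kn; apply/andP; split; first by rewrite /c ltrDl mulr_gt0.
  apply: (@le_lt_trans _ _ (c n)); last by rewrite cn ltrBlDr ltrDl.
  by rewrite /c lerD2l ler_wpM2r ?(ltW s0)// ler_nat.
pose X k := fine (expand (c k)).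
have cX k : (k <= n)%N -> contract (X k)%:E = c k.
  move=> /ck ck1; rewrite /X fineK ?expandK//.
    by rewrite inE ler_norml !ltW//; case/andP: ck1.
  by rewrite fin_numE expand_eqoo expand_eqNoo -!ltNge; case/andP: ck1 => -> ->.
have le_X k x : (k <= n)%N -> (X k <= x) = (c k <= contract x%:E).
  by move=> kn; rewrite -cX// le_contract lee_fin.
have ge_X k x : (k <= n)%N -> (x <= X k) = (contract x%:E <= c k).
  by move=> kn; rewrite -cX// le_contract lee_fin.
exists n, X; split=> [i ni|x|i x y ni|x].
- by rewrite -lte_fin -lt_contract (cX _ ni) (cX _ (ltnW ni)) cS ltrDl.
- rewrite ge_X// c0 => xs; rewrite /ball/= /ereal_ball.
  have -> : contract -oo%E = -1 :> R by [].
  rewrite -/s in nd.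
  have := contract_le1 x%:E; rewrite ler_norml => /andP[h1 h2].
  by rewrite ltr_norml; apply/andP; split; lra.
- have ni' := ltnW ni; rewrite !(le_X _ _ ni') !(ge_X _ _ ni) cS.
  move=> /andP[h1 h2] /andP[h3 h4].
  by rewrite /ball/= /ereal_ball ltr_norml; apply/andP; split; rewrite -/s in nd; lra.
- rewrite le_X// cn => xs; rewrite /ball/= /ereal_ball cX// cn.
  have := contract_le1 x%:E; rewrite ler_norml => /andP[h1 h2].
  by rewrite ltr_norml; apply/andP; split; rewrite -/s in nd; lra.
Qed.

Section interpolation.
Variables (X : nat -> R).

(** A smooth staircase with value g (X k) - g (X 0) at the node X k. It starts from
0, as a primitive must, and it is constant beyond the last node, so that its
derivative has compact support. *)
Definition interp n (g : R -> R) (x : R) : R :=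
  \sum_(i < n) (g (X i.+1) - g (X i)) * ramp (X i) (X i.+1) x.

Lemma interpB n g h x :
  interp n (fun y => g y - h y) x = interp n g x - interp n h x.
Proof.
rewrite /interp -sumrB; apply: eq_bigr => i _; rewrite -mulrBl; congr (_ * _).
by ring.
Qed.

Lemma interp_ge n g x : (forall i, (i < n)%N -> X i < X i.+1) ->
  X n <= x -> interp n g x = g (X n) - g (X 0%N).
Proof.
elim: n x => [|n IH] x Xn xn; first by rewrite /interp big_ord0 subrr.
rewrite /interp big_ord_recr/= -/(interp n g x) IH; last 2 first.
- by move=> i ni; apply: Xn; exact: ltnW.
- exact: le_trans (ltW (Xn _ (ltnSn n))) xn.
by rewrite (ramp_ge (Xn _ (ltnSn n)) xn) mulr1 addrC subrKA.
Qed.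

(** On a cell only one ramp is neither 0 nor 1: the staircase lies between the
values of g at the two ends of the cell, up to the small value at the first
node. *)
Lemma interp_close n g (eta : R) : 0 <= eta ->
  (forall i, (i < n)%N -> X i < X i.+1) ->
  (forall x, x <= X 0%N -> `|g x| <= eta) ->
  (forall i x y, (i < n)%N -> X i <= x <= X i.+1 -> X i <= y <= X i.+1 ->
     `|g x - g y| <= eta) ->
  (forall x, X n <= x -> `|g (X n) - g x| <= eta) ->
  forall x, `|interp n g x - g x| <= eta *+ 3.
Proof.
move=> eta0 Xn g0 gi gn x.
have [xn|/ltW xn] := leP x (X n); last first.
  rewrite interp_ge// addrAC.
  have := gn x xn; have := g0 _ (lexx (X 0%N)).
  rewrite !ler_norml => /andP[? ?] /andP[? ?].
  by apply/andP; split; rewrite -mulr_natr; lra.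
elim: n {gn} Xn gi x xn => [|n IH] Xn gi x xn.
  rewrite /interp big_ord0 sub0r normrN (le_trans (g0 x xn))//.
  by rewrite mulrS lerDl mulrn_wge0.
rewrite /interp big_ord_recr/= -/(interp n g x).
have Xn' i : (i < n)%N -> X i < X i.+1 by move=> ni; apply: Xn; exact: ltnW.
have XnS := Xn _ (ltnSn n).
have [xn'|/ltW xn'] := leP x (X n).
  rewrite (ramp_le XnS xn') mulr0 addr0; apply: IH => // i y z ni.
  by apply: gi; exact: ltnW.
rewrite interp_ge//.
have g1 := gi n x (X n) (ltnSn n); have g2 := gi n (X n.+1) (X n) (ltnSn n).
move: g1 g2; rewrite xn xn' !lexx (ltW XnS) => /(_ isT isT) + /(_ isT isT).
move: (g0 _ (lexx (X 0%N))); rewrite !ler_norml.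
have := ramp_itv (X n) (X n.+1) x.
move: (ramp _ _ x) (g (X n.+1)) (g (X n)) (g (X 0%N)) (g x) => h a b c y.
move=> /andP[h0 h1] /andP[c1 c2] /andP[y1 y2] /andP[a1 a2].
have [ah1 ah2] : - eta <= (a - b) * h /\ (a - b) * h <= eta by split; nra.
by apply/andP; split; rewrite -mulr_natr; lra.
Qed.

(** A bounded function has small oscillation at the scale of its bound, so the
previous estimate applies with twice the bound, and 7 = 3 * 2 + 1. *)
Lemma interp_bounded n g (eta : R) : 0 <= eta ->
  (forall i, (i < n)%N -> X i < X i.+1) ->
  (forall x, `|g x| <= eta) -> forall x, `|interp n g x| <= eta *+ 7.
Proof.
move=> eta0 Xn gb x.
have g2 y z : `|g y - g z| <= eta *+ 2.
  by rewrite (le_trans (ler_normB _ _))// mulr2n lerD.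
have g1 y : `|g y| <= eta *+ 2 by rewrite (le_trans (gb y))// mulr2n lerDl.
have := @interp_close n g (eta *+ 2) (mulrn_wge0 2 eta0) Xn (fun y _ => g1 y)
  (fun i y z _ _ _ => g2 y z) (fun y _ => g2 _ y) x.
move=> h; rewrite -(subrK (g x) (interp n g x)) (le_trans (ler_normD _ _))//.
by rewrite (le_trans (lerD h (gb x)))// -mulrnA -mulrSr.
Qed.

Definition interp2 n (f : R * R -> R) : R * R -> R :=
  fun z => interp n (fun x => interp n (fun y => f (x, y)) z.2) z.1.

(** Interpolation in y is a 3 eta approximation for each x. It is linear and
bounded, so it leaves the oscillation in x below 7 eta, and interpolation in x
costs at most 3 * 7 eta more. *)
Lemma interp2_close n (f : R * R -> R) (eta : R) : 0 <= eta ->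
  (forall i, (i < n)%N -> X i < X i.+1) ->
  (forall x y, x <= X 0%N -> `|f (x, y)| <= eta /\ `|f (y, x)| <= eta) ->
  (forall i x y z, (i < n)%N -> X i <= x <= X i.+1 -> X i <= y <= X i.+1 ->
     `|f (x, z) - f (y, z)| <= eta /\ `|f (z, x) - f (z, y)| <= eta) ->
  (forall x z, X n <= x ->
     `|f (X n, z) - f (x, z)| <= eta /\ `|f (z, X n) - f (z, x)| <= eta) ->
  forall z, `|interp2 n f z - f z| <= eta *+ 24.
Proof.
move=> eta0 Xn f0 fi fn [x y].
have h1 : `|interp n (fun y => f (x, y)) y - f (x, y)| <= eta *+ 3.
  apply: (@interp_close n (fun y => f (x, y))) => //.
  - by move=> t /(f0 t x)[].
  - by move=> i s t ni si ti; have [] := fi i s t x ni si ti.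
  - by move=> t /(fn t x)[].
have h2 : `|interp2 n f (x, y) - interp n (fun y => f (x, y)) y| <= eta *+ 7 *+ 3.
  apply: (@interp_close n (fun x => interp n (fun y => f (x, y)) y)) => //.
  - exact: mulrn_wge0.
  - by move=> t tX; apply: interp_bounded => // s; have [] := f0 t s tX.
  - move=> i s t ni si ti; rewrite -interpB; apply: interp_bounded => // r.
    by have [] := fi i s t r ni si ti.
  - move=> t tX; rewrite -interpB; apply: interp_bounded => // r.
    by have [] := fn t r tX.
rewrite -(subrKA (interp n (fun y => f (x, y)) y)) (le_trans (ler_normD _ _))//.
by rewrite (le_trans (lerD h2 h1))// -mulrnA -mulrnDr.
Qed.

End interpolation.

Section staircase.
Variable M : R.

(** The one-variable factors of the approximants: a primitive has to start from 0,
and its density has to have compact support. *)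
Definition staircase (f : R -> R) := [/\ elementary f,
  forall x, x <= - M -> f x = 0 & forall x, M < `|x| -> derive1 f x = 0].

Lemma staircase0 : staircase (fun=> 0).
Proof.
split=> // [|x _]; last by rewrite derive1_cst.
rewrite (_ : (fun=> 0) = fun x => 0 * flat 0 x); last first.
  by apply/funext => x; rewrite mul0r.
by apply: elem_scale; exact: elem_flat.
Qed.

Lemma staircase_lin a f g : staircase f -> staircase g ->
  staircase (fun x => a * f x + g x).
Proof.
move=> [ef f0 f'0] [eg g0 g'0]; split.
- exact: elem_lin.
- by move=> x xM; rewrite f0// g0// mulr0 addr0.
- move=> x xM; rewrite derive1_lin ?f'0// ?g'0// ?mulr0 ?addr0//.
    exact: elem_derivable.
  exact: elem_derivable.
Qed.

Lemma staircase_ramp u v : u < v -> `|u| <= M -> `|v| <= M -> staircase (ramp u v).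
Proof.
move=> uv uM vM; split; first exact: elem_ramp.
  move=> x xM; apply: (ramp_le uv); apply: (le_trans xM).
  by move: uM; rewrite ler_norml => /andP[].
move=> x; have [x0|x0] := leP 0 x.
  rewrite (ger0_norm x0) => xM; apply: (ramp_derive1_gt uv).
  by apply: le_lt_trans xM; exact: le_trans (ler_norm _) vM.
rewrite (ltr0_norm x0) => xM; apply: (ramp_derive1_lt uv).
move: uM; rewrite ler_norml => /andP[Mu _]; apply: lt_le_trans Mu.
by rewrite ltrNr.
Qed.

Lemma staircase_interp X n g : (forall i, (i < n)%N -> X i < X i.+1) ->
  (forall i, (i <= n)%N -> `|X i| <= M) -> staircase (interp X n g).
Proof.
elim: n => [|n IH] Xn XM.
  rewrite (_ : interp X 0 g = fun=> 0); first exact: staircase0.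
  by apply/funext => x; rewrite /interp big_ord0.
rewrite (_ : interp X n.+1 g = fun x =>
    (g (X n.+1) - g (X n)) * ramp (X n) (X n.+1) x + interp X n g x).
  apply: staircase_lin; last by apply: IH => i ni; [exact/Xn/ltnW|exact/XM/ltnW].
  by apply: staircase_ramp; [exact: Xn|exact: XM|exact: XM].
by apply/funext => x; rewrite /interp big_ord_recr/= addrC.
Qed.

(** The analogue in the plane: the mixed derivative of such a function is a test
function, whose primitive is the function itself. *)
Definition staircase2 (Phi : R * R -> R) := [/\ smooth Phi,
  forall z, z.1 <= - M \/ z.2 <= - M -> Phi z = 0 &
  vanishes_off M (partials [:: true; false] Phi)].

Lemma staircase2_lin a Phi Psi : staircase2 Phi -> staircase2 Psi ->
  staircase2 (a *: (Phi : R * R -> R) + Psi).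
Proof.
move=> [sf f0 f'0] [sg g0 g'0]; split; first exact: smooth_lin.
  by move=> z zM; rewrite !fctE f0// g0// scaler0 addr0.
by move=> z zM; rewrite partials_lin// !fctE f'0// g'0// scaler0 addr0.
Qed.

Lemma staircase2_tensor f g : staircase f -> staircase g -> staircase2 (tensor f g).
Proof.
move=> [ef f0 f'0] [eg g0 g'0]; split; first exact: smooth_tensor.
  by move=> z [/f0|/g0] h; rewrite /tensor h ?mul0r ?mulr0.
by rewrite d12_tensor//; exact: vanishes_off_tensor.
Qed.

(** By linearity the double interpolation is a sum of tensor products of a ramp
in x and a staircase in y. *)
Lemma staircase2_interp2 X n (f : R * R -> R) : (forall i, (i < n)%N -> X i < X i.+1) ->
  (forall i, (i <= n)%N -> `|X i| <= M) -> staircase2 (interp2 X n f).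
Proof.
move=> Xn XM.
have sf x : staircase (interp X n (fun y => f (x, y))) by exact: staircase_interp.
suff H m : (m <= n)%N -> staircase2 (fun z =>
    interp X m (fun x => interp X n (fun y => f (x, y)) z.2) z.1) by exact: H.
elim: m => [|m IH] mn.
  rewrite (_ : (fun z => _) = tensor (fun=> 0) (fun=> 0)).
    by apply: staircase2_tensor; exact: staircase0.
  by apply/funext => z; rewrite /interp big_ord0 /tensor mul0r.
rewrite (_ : (fun z => _) = 1 *: (tensor (ramp (X m) (X m.+1)) (fun y =>
    -1 * interp X n (fun y => f (X m, y)) y +
    interp X n (fun y => f (X m.+1, y)) y) : R * R -> R) +
  (fun z => interp X m (fun x => interp X n (fun y => f (x, y)) z.2) z.1)).
  apply: staircase2_lin; last exact/IH/ltnW.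
  apply: staircase2_tensor; last exact: staircase_lin.
  by apply: staircase_ramp; [exact: Xn|exact/XM/ltnW|exact: XM].
apply/funext => z; rewrite {1}/interp big_ord_recr/= addrC scale1r.
rewrite -[RHS]/(_ + _); congr (_ + _).
by rewrite /tensor mulrC mulN1r addrC.
Qed.

Lemma staircase2_primitive Phi : staircase2 Phi ->
  exists phi : testfun R, restrict_plane (cumul phi) = Phi.
Proof.
move=> [sPhi Phi0 v].
have s12 : smooth (partials [:: true; false] Phi).
  by move=> s; have := sPhi (s ++ [:: true; false]); rewrite /partials foldr_cat.
exists (TestFun (vanishes_off_test s12 v)); apply/funext => z.
by rewrite /restrict_plane /cumul /Rintegral (integral_lower_quadrant z sPhi Phi0 v).
Qed.

End staircase.

(** Both variables use the same grid, fine enough for the modulus of uniform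
continuity of F; the mixed derivative of the double interpolation is a test
function. *)
Lemma test_approx F e : Bc F -> 0 < e ->
  exists phi : testfun R, forall z, `|F z - cumul phi z| <= e.
Proof.
move=> [cF F0] e0; pose eta := e / 24.
have eta0 : 0 < eta by rewrite divr_gt0.
have [d d0 Fd] := Heine_Cantor cF eta0.
have [n [X [Xn X0 Xi XN]]] := grid d0.
pose f := restrict_plane F.
(* a square containing all the nodes *)
pose M := \sum_(i < n.+1) `|X i|.
have XM i : (i <= n)%N -> `|X i| <= M.
  rewrite -ltnS => ni; rewrite /M (bigD1 (Ordinal ni))//= lerDl.
  exact: sumr_ge0.
have bxx (a : \bar R) : ball a d a by exact: ballxx.
have close z : `|interp2 X n f z - f z| <= eta *+ 24.
  apply: interp2_close => //; first exact: ltW.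
  - move=> x y xX; have bx := X0 x xX; have [F1 F2] := F0 y%:E; split.
      by have := Fd (-oo%E, y%:E) (x%:E, y%:E) (conj bx (bxx _)); rewrite F1 sub0r normrN.
    by have := Fd (y%:E, -oo%E) (y%:E, x%:E) (conj (bxx _) bx); rewrite F2 sub0r normrN.
  - move=> i x y z' ni xi yi; have bxy := Xi i x y ni xi yi; split.
      exact: (Fd (x%:E, z'%:E) (y%:E, z'%:E) (conj bxy (bxx _))).
    exact: (Fd (z'%:E, x%:E) (z'%:E, y%:E) (conj (bxx _) bxy)).
  - move=> x z' xX; have bx := XN x xX; split.
      exact: (Fd ((X n)%:E, z'%:E) (x%:E, z'%:E) (conj bx (bxx _))).
    exact: (Fd (z'%:E, (X n)%:E) (z'%:E, x%:E) (conj (bxx _) bx)).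
have [phi cphi] := staircase2_primitive (staircase2_interp2 f Xn XM).
exists phi; apply: (@le_dense_real _ (F - cumul phi)).
  move=> z; apply: cvgB; first exact: cF.
  by apply: cumul_continuous; exact: test_integrable.
move=> z; rewrite -[restrict_plane _ z]/(f z - restrict_plane (cumul phi) z).
by rewrite cphi distrC (le_trans (close z))// -[leLHS]mulr_natr divfK.
Qed.

(** By uniqueness the chosen primitive is F. *)
Lemma alexiewicz_le (T : testfun R -> R) F (c : R) : primitive_of T F ->
  (forall z, `|F z| <= c) -> alexiewicz T <= c.
Proof.
move=> TF Fc; rewrite /alexiewicz.
have -> : primitive T = F.
  by apply: (primitive_unique _ TF); apply: (@xgetPex _ (cst 0)); exists F.
apply: ge_sup; first by exists `|F (0%E, 0%E)|, (0%E, 0%E).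
by move=> _ [z _ <-].
Qed.

Lemma test_distr_L1 : @test_distr R `<=` @L1_distr R.
Proof. by move=> _ [phi _ <-]; exists phi => //=; exact: test_integrable. Qed.

Lemma test_distr_dense (T : testfun R -> R) : Ac T -> forall e : R, 0 < e ->
  exists2 U, test_distr U & alexiewicz (T - U) < e.
Proof.
move=> [_ [F [BF TF]]] e e0.
have e20 : 0 < e / 2 by rewrite divr_gt0.
have [phi phiF] := test_approx BF e20.
exists (regular_distr phi); first by exists phi.
apply: (@le_lt_trans _ _ (e / 2)); last by rewrite ltr_pdivrMr// ltr_pMr// ltr1n.
have intphi := test_integrable phi.
have [cF F0] := BF; have [cP P0] := cumul_Bc intphi.
apply: (alexiewicz_le (F := F - cumul phi)) => //; split.
  split=> [z|s]; first by apply: cvgB; [exact: cF|exact: cP].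
  by have [f1 f2] := F0 s; have [p1 p2] := P0 s; rewrite !fctE f1 f2 p1 p2 subrr.
rewrite d12_regular_distrB// TF; congr (_ - _); apply/funext => psi.
exact: cumul_by_parts.
Qed.

End density.

Theorem proposition4p6 (R : realType) :
  dense_in_Ac (@L1_distr R) /\ dense_in_Ac (@test_distr R).
Proof.
split; split=> [|T AT e e0].
- exact: L1_distr_Ac.
- have [U tU Ue] := test_distr_dense AT e0.
  by exists U => //; exact: test_distr_L1.
- by move=> T /test_distr_L1; exact: L1_distr_Ac.
- exact: test_distr_dense.
Qed.
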